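(* For any sequence of polynomials $\mathfrak p=(p_d)_{d\ge1}$, $p_d\in\mathcal P_d(\mathbb R)$, with infinitesimal distribution $(\mu,\mu')$, the following relation of formal power series holds: $$G_{\mu'}=-(\widehat R_{\mathfrak p}\circ G_\mu)\cdot G'_\mu-H_\mu.$$
   Context: $\mathcal P_d(\mathbb R)$ is the set of monic real polynomials of degree $d$ with only real roots. For $p_d\in\mathcal P_d(\mathbb R)$ with roots $\lambda_1,\dots,\lambda_d$ (with multiplicity), $m_n(p_d)=\frac1d\sum_k\lambda_k^n$. Write $p_d(x)=\sum_{k=0}^d x^{d-k}(-1)^k\binom dk\mathsf e_k(p_d)$. The finite-free cumulants are $\kappa_n(p_d)=\frac{(-d)^{n-1}}{(n-1)!}\sum_{\pi\in P(n)}(-1)^{|\pi|-1}(|\pi|-1)!\prod_{V\in\pi}\mathsf e_{|V|}(p_d)$, $1\le n\le d$, with $P(n)$ the set of partitions of $[n]=\{1,\dots,n\}$ and $|\pi|$ the number of blocks. A sequence $\mathfrak p$ has infinitesimal distribution $(\mu,\mu')$ if $\mu$ is a probability distribution on $\mathbb R$ with finite moments $m_n(\mu)$ of all orders, $m_n(p_d)\to m_n(\mu)$ for all $n\ge0$, the limits $m_n'(\mathfrak p)=\lim_{d\to\infty}d\,(m_n(p_d)-m_n(\mu))$ exist for all $n\ge1$, and $\mu':\mathbb R[x]\to\mathbb R$ is the linear functional with $\mu'(1)=0$, $\mu'(x^n)=m_n'(\mathfrak p)$. The cumulant fluctuations of such $\mathfrak p$ are the numbers $\widehat r_n(\mathfrak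 p)$ with $\kappa_n(p_d)=r_n(\mu)+\frac1d\widehat r_n(\mathfrak p)+o(1/d)$ as $d\to\infty$ (they always exist). $NC(n)$ is the set of non-crossing partitions of $[n]$; for a sequence $(u_n)$, $u_\pi=\prod_{V\in\pi}u_{|V|}$ and $u_\sigma=\prod_c u_{|c|}$ over cycles $c$ (fixed points included) of a permutation $\sigma$. Free cumulants $r_n(\mu)$ are defined recursively by $m_n(\mu)=\sum_{\pi\in NC(n)}r_\pi(\mu)$. Formal power series (identities, compositions, derivatives are formal): $G_\mu(z)=\sum_{n\ge0}m_n(\mu)z^{-n-1}$; $G_{\mu'}(z)=\sum_{n\ge0}\mu'(x^n)z^{-n-1}$; $\widehat R_{\mathfrak p}(z)=\sum_{n\ge1}\widehat r_n(\mathfrak p)z^{n-1}$; $H_\mu(z)=\sum_{n\ge2}h_n(\mu)z^{-n-1}$ with $h_n(\mu)=\frac n2\sum_{t+s=n,\ \sigma\in S_{NC}(t,s)}\frac{r_\sigma(\mu)}{ts}$, the sum over ordered pairs of integers $t,s\ge1$. Here, with $\gamma_{t,s}=(1,\dots,t)(t+1,\dots,t+s)\in S_{t+s}$, $S_{NC}(t,s)$ is the set of $\sigma\in S_{t+s}$ such that $\langle\sigma,\gamma_{t,s}\rangle$ acts transitively on $[t+s]$ and $|\sigma|+|\sigma^{-1}\gamma_{t,s}|=t+s$, $|\cdot|$ counting cycles including fixed points. *)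

(* Defs.v *)
From HB Require Import structures.
From mathcomp Require Import all_boot all_order all_algebra all_fingroup.
From mathcomp Require Import all_classical all_reals all_analysis.
From mathcomp Require Import complex polyrcf.

Set Implicit Arguments.
Unset Strict Implicit.
Unset Printing Implicit Defensive.

Import Order.TTheory GRing.Theory Num.Theory.
Import numFieldNormedType.Exports.

Local Open Scope ring_scope.

(** * Real-rooted polynomials *)

Definition monic_real_rooted (R : realType) (d : nat) (p : {poly R}) : Prop :=
  [/\ p \is monic, size p = d.+1 &
      forall z : R[i], root (map_poly (real_complex R) p) z -> complex.Im z = 0].

Definition roots_with_mult (R : realType) (p : {poly R}) : seq R :=
  flatten [seq nseq (mup x p) x | x <- rootsR p].

Definition poly_moment (R : realType) (d : nat) (p : {poly R}) (n : nat) : R :=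
  d%:R^-1 * \sum_(x <- roots_with_mult p) x ^+ n.

(* Solves p(x) = \sum_(k <= d) x^(d-k) (-1)^k 'C(d, k) e_k for e_k, k <= d. *)
Definition norm_elem (R : realType) (d : nat) (p : {poly R}) (k : nat) : R :=
  (-1) ^+ k * p`_(d - k) / 'C(d, k)%:R.

(** * Set partitions and cumulants *)

(* u_pi for a partition pi, and u_sigma on [porbits sigma]. *)
Definition block_prod (R : realType) (T : finType) (u : nat -> R)
    (P : {set {set T}}) : R :=
  \prod_(V in P) u #|V|.

Definition set_partitions (n : nat) : {set {set {set 'I_n}}} :=
  [set P | finset.partition P [set: 'I_n]%SET]%SET.

(* Only meaningful for 1 <= n <= d. *)
Definition ff_cumulant (R : realType) (d : nat) (p : {poly R}) (n : nat) : R :=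
  (- d%:R) ^+ n.-1 / (n.-1)`!%:R *
  \sum_(P in set_partitions n)
     (-1) ^+ (#|P|.-1) * (#|P|.-1)`!%:R * block_prod (norm_elem d p) P.

Definition noncrossing (n : nat) (P : {set {set 'I_n}}) : bool :=
  [forall V in P, forall W in P,
   forall i in V, forall j in W, forall k in V, forall l in W,
     (i < j)%N && (j < k)%N && (k < l)%N ==> (V == W)].

Definition nc_partitions (n : nat) : {set {set {set 'I_n}}} :=
  [set P in set_partitions n | noncrossing P]%SET.

(* The one-block partition contributes exactly r_n to \sum_(pi in NC(n)) r_pi,
   and all other terms involve r_k with k < n only; [free_cumulant_upto m n]
   is correct on arguments <= n. *)
Fixpoint free_cumulant_upto (R : realType) (m : nat -> R) (n : nat) : nat -> R :=
  if n is n'.+1 then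
    let r := free_cumulant_upto m n' in
    fun k => if k == n'.+1 then
               m n'.+1 - \sum_(P in nc_partitions n'.+1
                               | P != [set [set: 'I_n'.+1]]%SET) block_prod r P
             else r k
  else fun=> 0.

Definition free_cumulant (R : realType) (m : nat -> R) (n : nat) : R :=
  free_cumulant_upto m n n.

Lemma free_cumulant_uptoE (R : realType) (m : nat -> R) (n k : nat) :
  (k <= n)%N -> free_cumulant_upto m n k = free_cumulant m k.
Proof.
elim: n => [|n IHn]; first by rewrite leqn0 => /eqP->.
rewrite leq_eqVlt => /predU1P[->//|]; rewrite ltnS => kn /=.
by rewrite ifN ?IHn// neq_ltn ltnS kn.
Qed.

Lemma free_moment_cumulant (R : realType) (m : nat -> R) (n : nat) :
  (0 < n)%N ->
  m n = \sum_(P in nc_partitions n) block_prod (free_cumulant m) P.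
Proof.
case: n => // n _.
have T0 : [set: 'I_n.+1]%SET != finset.set0.
  by apply/finset.set0Pn; exists ord0; rewrite finset.in_setT.
have inT : [set [set: 'I_n.+1]]%SET \in nc_partitions n.+1.
  rewrite !finset.inE; apply/andP; split.
    rewrite /finset.partition /finset.trivIset /finset.cover !big_set1 !eqxx /=.
    by rewrite finset.in_set1 eq_sym T0.
  apply/'forall_implyP => V; rewrite finset.in_set1 => /eqP->.
  apply/'forall_implyP => W; rewrite finset.in_set1 => /eqP->.
  by do 4 (apply/'forall_implyP => ? _); rewrite eqxx implybT.
rewrite (bigD1 _ inT) /= {1}/block_prod big_set1 cardsT card_ord.
rewrite {1}/free_cumulant /= eqxx.
rewrite [X in _ = _ - X + _](eq_bigr (block_prod (free_cumulant m))) ?subrK//.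
move=> P /andP[]; rewrite !finset.inE => /andP[Ppart _] PT.
apply: eq_bigr => V VP; apply: free_cumulant_uptoE.
rewrite -ltnS -[X in (_ < X)%N](card_ord n.+1) -cardsT proper_card//.
rewrite finset.properEneq finset.subsetT andbT; apply: contraNneq PT => VT.
case/and3P: Ppart => _ /finset.trivIsetP tP P0; rewrite VT in VP.
apply/eqP/finset.setP => W; rewrite finset.in_set1.
apply/idP/eqP => [WP|->//].
apply/eqP; apply: contraNT P0 => WT.
have := tP _ _ WP VP WT; rewrite -finset.setI_eq0 finset.setIT => /eqP W0.
by rewrite -W0.
Qed.

(** * Annular non-crossing permutations *)

(* The permutation (1, ..., t)(t+1, ..., t+s), on {0, ..., t+s-1}. *)
Definition two_cycles_fun (t s : nat) (i : 'I_(t + s)) : 'I_(t + s) :=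
  match fintype.split i with
  | inl j => lshift s (ordS j)
  | inr k => rshift t (ordS k)
  end.

Lemma two_cycles_inj (t s : nat) : injective (@two_cycles_fun t s).
Proof.
move=> i j; rewrite /two_cycles_fun.
case: (split_ordP i) => a -> ; case: (split_ordP j) => b -> /eqP.
- by rewrite eq_lshift => /eqP/ordS_inj->.
- by rewrite eq_lrshift.
- by rewrite eq_rlshift.
- by rewrite eq_rshift => /eqP/ordS_inj->.
Qed.

Definition two_cycles (t s : nat) : 'S_(t + s) := perm (@two_cycles_inj t s).

Definition annular_nc (t s : nat) : {set 'S_(t + s)} :=
  [set sg : 'S_(t + s)
   | [transitive <<[set sg; two_cycles t s]%SET>>, on [set: 'I_(t + s)]%SET | 'P]%g
   && (#|porbits sg| + #|porbits (sg^-1 * two_cycles t s)%g| == t + s)%N]%SET.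

Definition annular_coef (R : realType) (r : nat -> R) (n : nat) : R :=
  n%:R / 2 *
  \sum_(t < n.+1) \sum_(s < n.+1 | [&& 0 < t, 0 < s & t + s == n]%N)
     \sum_(sg in annular_nc t s) block_prod r (porbits sg) / (t%:R * s%:R).

(** * Formal power series *)

(* A series is given by its coefficients. A series in 1/z, such as the Cauchy
   transform, is [f] with [f k] the coefficient of z^(-k). *)

Definition fps_mul (R : realType) (f g : nat -> R) : nat -> R :=
  fun n => \sum_(i < n.+1) f i * g (n - i)%N.

Definition fps_pow (R : realType) (f : nat -> R) (k : nat) : nat -> R :=
  iter k (fps_mul f) (fun n => (n == 0%N)%:R).

(* a o f = \sum_k a_k f^k, for f with zero constant term, so that f^k only
   contributes to coefficients of index n >= k. *)
Definition fps_comp (R : realType) (a f : nat -> R) : nat -> R :=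
  fun n => \sum_(k < n.+1) a k * fps_pow f k n.

(* d/dz of a series in 1/z: z^(-k) becomes - k z^(-k-1). *)
Definition fps_deriv_inv (R : realType) (f : nat -> R) : nat -> R :=
  fun n => if n is k.+1 then - (k%:R * f k) else 0.

Definition cauchy_series (R : realType) (m : nat -> R) : nat -> R :=
  fun k => if k is n.+1 then m n else 0.

Definition annular_series (R : realType) (r : nat -> R) : nat -> R :=
  fun k => if k is n.+1 then (if (2 <= n)%N then annular_coef r n else 0) else 0.

(* [c] starts at index 1: this is \sum_(n >= 1) c_n z^(n-1). *)
Definition R_series (R : realType) (c : nat -> R) : nat -> R :=
  fun n => c n.+1.

(** * Infinitesimal distributions *)

Section Distributions.
Local Open Scope classical_set_scope.
Variable R : realType.
Implicit Types (p : nat -> {poly R}) (mu : probability (measurableTypeR R) R).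

Definition moment mu (n : nat) : R := \int[mu]_x (x ^+ n).

Definition infinitesimal_distribution p mu (mu' : {scalar {poly R}}) : Prop :=
  [/\ forall n, mu.-integrable setT (fun x => (x ^+ n)%:E),
      forall n, (fun d => poly_moment d (p d) n) @ \oo --> moment mu n,
      mu' 1 = 0 &
      forall n, (0 < n)%N ->
        (fun d => d%:R * (poly_moment d (p d) n - moment mu n)) @ \oo
          --> mu' 'X^n].

Definition cumulant_fluctuations p mu (rhat : nat -> R) : Prop :=
  forall n, (0 < n)%N ->
    (fun d => ff_cumulant d (p d) n : R^o) =
      (fun d => free_cumulant (moment mu) n + d%:R^-1 * rhat n : R^o)
      +o_\oo (fun d => d%:R^-1 : R^o).

End Distributions.

(* Main.v *)
Require Import Defs.
From HB Require Import structures.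
From mathcomp Require Import all_boot all_order all_algebra all_fingroup.
From mathcomp Require Import zify ring.

(** The proof rests on one exact formula and two ways of reading it.

    Write D for the degree, kappa for the finite free cumulants and e for the
    normalised coefficients of a real-rooted polynomial p.  Inverting the
    definition of kappa on the partition lattice (a logarithm of exponential
    generating functions) gives e_n as a sum over permutations of [n] in which a
    cycle of length k weighs kappa_k (-1/D)^(k-1).  The falling factorial
    D (D-1) ... (D-n+1) is also a sum over permutations, a cycle weighing
    D (-1)^(k-1).  Hence the elementary symmetric functions of the roots, up to
    sign and a factorial, are sums over pairs (s, t) of permutations.  Newton's
    identities say that passing to power sums is taking connected components, so
    (n-1)! m_n(p) is the sum of (-1/D)^(n+1-|s|-|t|) kappa_s over the pairs that
    generate a transitive group ([poly_moment_ff], [ff_moment_genus]).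

    Exponents.  For a transitive pair, |s| + |t| + |st| <= n + 2
    ([genus_bound]).  So the exponent is nonnegative, and by parity exponent 1
    means that st has exactly two cycles.  The permutations with two cycles
    of given lengths are all conjugate and can be counted, so the coefficient of
    -1/D is exactly the annular sum h_n ([genus_sum_annular]).

    Leading term.  The polynomial p with fixed cumulants satisfies a linear
    differential equation whose form for the Cauchy transform is the loop equation
    G = w (1 + sum_k kappa_k Q_k), with w = 1/z, Q_0 = 1 and
    Q_(k+1) = G Q_k + Q_k'/D ([loop_equation]).  Letting D grow with kappa
    fixed, the leading coefficients satisfy G = w (1 + sum_k kappa_k G^k).
    Non-crossing partitions obey the same recursion, obtained by removing the
    largest point and cutting at its predecessor in its block
    ([nc_sum_pointed_max]).  Hence the leading coefficient is the sum over
    non-crossing partitions ([genus0_noncrossing]).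

    Conclusion.  Up to o(1/d), m_n(p_d) is the non-crossing sum of the cumulants
    of p_d minus h_n/d.  Solving for the top cumulant shows by induction that
    the cumulants have first-order fluctuations ([has_fluct_cumulant]).
    Linearising G = w (1 + sum_k kappa_k G^k) in the direction of the
    fluctuations, and comparing with the derivative of the same equation in z,
    shows that the non-crossing sum fluctuates by the coefficients of
    - (Rhat o G) G' ([linearised_equation]); what remains is the annular series. *)

Set Implicit Arguments.
Unset Strict Implicit.
Unset Printing Implicit Defensive.

Import Order.TTheory GRing.Theory Num.Theory.
Local Open Scope ring_scope.

(** * The genus bound for a pair of permutations *)

Lemma mem_porbit1 (T : finType) (s : {perm T}) x : s x \in porbit s x.
Proof. by have := mem_porbit s 1 x; rewrite expg1. Qed.

Lemma card_porbits1 (T : finType) : #|porbits (1 : {perm T})| = #|T|.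
Proof.
rewrite card_imset ?cardsT // => x y /eqP; rewrite eq_porbit_mem.
by case/porbitP => i ->; rewrite expg1n perm1.
Qed.

Lemma card_porbits_le (T : finType) (s : {perm T}) : (#|porbits s| <= #|T|)%N.
Proof. exact: leq_imset_card. Qed.

Lemma card_porbits_max (T : finType) (s : {perm T}) :
  (#|T| <= #|porbits s|)%N -> s = 1%g.
Proof.
move=> le; apply/permP => x; rewrite perm1.
have /imset_injP inj : #|porbits s| == #|T| by rewrite eqn_leq card_porbits_le.
apply: inj => //.
by apply/eqP; rewrite eq_porbit_mem mem_porbit1.
Qed.

Lemma porbit_invariant (T : finType) (L : Type) (s : {perm T}) (f : T -> L) x y :
  (forall z, f (s z) = f z) -> x \in porbit s y -> f x = f y.
Proof.
move=> fs /porbitP[i ->]; elim: i => [|i IH]; first by rewrite perm1.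
by rewrite expgSr permM fs.
Qed.

(** The genus bound with the number of orbits of <s, t> replaced by the number of
    values of an invariant function f, which makes an induction possible.  The
    induction is on the minimal number of transpositions whose product is t.
    Move a transposition q = (x y) with y = t x from t to s: the product is
    unchanged and t' = q t has one cycle more than t.  Let f be invariant under
    t' and s' = s q.  If f identifies x and y, it is invariant under s and t, and
    s has at most one cycle more than s'.  Otherwise x and y lie in different
    cycles of s', which q joins, so s has one cycle less than s'; identifying the
    values of f at x and y restores invariance and costs one value, hence 2 on
    both sides of the bound. *)
Lemma genus_bound_label (T : finType) (s t : {perm T}) :
  exists f : T -> {set T}, [/\ forall x, f (s x) = f x, forall x, f (t x) = f x &
   (#|porbits s| + #|porbits t| + #|porbits (s * t)%g| <= #|T| + #|f @: setT|.*2)%N].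
Proof.
move En: (#|T| - #|porbits t|)%N => n.
elim: n s t En => [|n IH] s t En.
  have -> : t = 1%g by apply: card_porbits_max; rewrite -subn_eq0 En.
  exists (porbit s); split=> [x|x|]; last 2 first.
  - by rewrite perm1.
  - have -> : [set porbit s x | x in [set: T]] = porbits s.
      by apply/setP => A; apply/imsetP/imsetP => -[x _ ->]; exists x.
    by rewrite mulg1 card_porbits1 addnAC addnn addnC.
  by apply/eqP; rewrite eq_porbit_mem mem_porbit1.
have [x tx] : exists x, t x != x.
  apply/existsP; rewrite -negb_forall; apply: contraT => /negPn/forallP t1.
  have t1' : t = 1%g by apply/permP => x; rewrite perm1; apply/eqP.
  by move: En; rewrite t1' card_porbits1 subnn.
set y := t x.
have xy : x != y by rewrite eq_sym.
have xt : x \in porbit t y by rewrite porbit_sym mem_porbit1.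
pose q := tperm x y; pose s' := (s * q)%g; pose t' := (q * t)%g.
have ct : #|porbits t'| = #|porbits t|.+1.
  by have := porbits_mul_tperm t x y; rewrite /= xt xy addn0 addn1.
have st : (s' * t' = s * t)%g by rewrite /s' /t' mulgA -(mulgA s) tperm2 mulg1.
have cs : (#|porbits s| + (x \notin porbit s' y).*2 = #|porbits s'|.+1)%N.
  have := porbits_mul_tperm s'^-1 x y; rewrite /= xy addn1 porbitsV porbitV => <-.
  by rewrite -[porbits s]porbitsV /s' invMg tpermV mulgA tperm2 mul1g.
have [f [fs ft le]] : exists f : T -> {set T},
    [/\ forall x, f (s' x) = f x, forall x, f (t' x) = f x &
  (#|porbits s'| + #|porbits t'| + #|porbits (s' * t')%g| <= #|T| + #|f @: setT|.*2)%N].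
  by apply: IH; rewrite ct; move: En; lia.
have tE z : t z = t' (q z) by rewrite /t' permM tpermK.
have sE z : s z = q (s' z) by rewrite /s' permM tpermK.
have xy' : f x != f y -> x \notin porbit s' y.
  by apply: contra => /(porbit_invariant fs) ->.
rewrite st ct in le.
have [fxy|fxy] := eqVneq (f x) (f y).
  have fq z : f (q z) = f z by rewrite /q; case: tpermP => [->|->|].
  exists f; split=> [z|z|]; rewrite ?sE ?tE ?ft ?fq ?fs //.
  by move: le cs; lia.
(* Merging two values makes f invariant under q, hence under s and t. *)
pose mg A := if A == f y then f x else A.
have fq z : mg (f (q z)) = mg (f z).
  by rewrite /q /mg; case: tpermP => [->|->|//]; rewrite eqxx (negPf fxy).
exists (mg \o f); split=> [z|z|] /=; rewrite ?sE ?tE ?ft ?fq ?fs //.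
have: (#|f @: setT| <= #|(mg \o f) @: setT|.+1)%N.
  rewrite (cardsD1 (f y)) imset_f // add1n ltnS subset_leq_card //.
  apply/subsetP => A /setD1P[neq /imsetP[z _ zE]]; apply/imsetP; exists z => //.
  by rewrite /= /mg -zE (negPf neq).
move: le cs; rewrite (xy' fxy) /=; move: #|_ @: _| #|_ @: _| => a b.
by rewrite -!addnn; lia.
Qed.

(** * Sums over pairs of permutations *)

Definition stable (T : finType) (s : {perm T}) (W : {set T}) :=
  [forall y in W, s y \in W].

Lemma stableP (T : finType) (s : {perm T}) (W : {set T}) :
  reflect {in W, forall y, s y \in W} (stable s W).
Proof. by apply: (iffP forallP) => h y; [move/implyP: (h y)|apply/implyP/h]. Qed.

(** The orbit of x under <s, t>, as the least stable set containing x: in this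
    form it is visibly unaffected by what s and t do outside a stable set. *)
Definition conn_comp (T : finType) (s t : {perm T}) (x : T) : {set T} :=
  \bigcap_(W : {set T} | [&& x \in W, stable s W & stable t W]) W.

Lemma conn_compP (T : finType) (s t : {perm T}) x y :
  reflect (forall W : {set T}, x \in W -> stable s W -> stable t W -> y \in W)
          (y \in conn_comp s t x).
Proof.
apply: (iffP bigcapP) => h W; first by move=> *; apply: h; apply/and3P.
by case/and3P; apply: h.
Qed.

Lemma conn_comp_id (T : finType) (s t : {perm T}) x : x \in conn_comp s t x.
Proof. exact/conn_compP. Qed.

Lemma conn_comp_stable (T : finType) (s t : {perm T}) x :
  stable s (conn_comp s t x) /\ stable t (conn_comp s t x).
Proof.
by split; apply/stableP => y /conn_compP yW; apply/conn_compP => W xW sW tW;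
  [apply: (stableP _ _ sW)|apply: (stableP _ _ tW)]; apply: yW.
Qed.

Lemma conn_comp_min (T : finType) (s t : {perm T}) x (W : {set T}) :
  x \in W -> stable s W -> stable t W -> conn_comp s t x \subset W.
Proof. by move=> *; apply/subsetP => y /conn_compP; apply. Qed.

Lemma stable_porbit (T : finType) (s : {perm T}) (W : {set T}) x :
  stable s W -> x \in W -> porbit s x \subset W.
Proof.
move=> /stableP sW xW; apply/subsetP => y /porbitP[i ->].
by elim: i => [|i IH]; rewrite ?perm1 // expgSr permM sW.
Qed.

Lemma stable_mem (T : finType) (s : {perm T}) (W : {set T}) x :
  stable s W -> (s x \in W) = (x \in W).
Proof.
move=> sW; apply/idP/idP => [sxW|]; last exact: (stableP _ _ sW).
apply: (subsetP (stable_porbit sW sxW)).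
by rewrite porbit_sym mem_porbit1.
Qed.

Lemma eq_in_porbit (T : finType) (s s' : {perm T}) (W : {set T}) x :
  stable s W -> {in W, s =1 s'} -> x \in W -> porbit s x = porbit s' x.
Proof.
move=> sW ss' xW; have si i : (s ^+ i)%g x = (s' ^+ i)%g x /\ (s ^+ i)%g x \in W.
  elim: i => [|i [IH IHW]]; first by rewrite !expg0 perm1.
  by rewrite !expgSr !permM -IH -ss' // (stableP _ _ sW).
apply/setP => y; apply/porbitP/porbitP => -[i ->]; exists i; first by case: (si i).
by case: (si i).
Qed.

Lemma perm_on_stable (T : finType) (s : {perm T}) (V W : {set T}) :
  perm_on V s -> V \subset W -> stable s W.
Proof.
move=> sV VW; apply/stableP => y yW.
have [yV|yV] := boolP (y \in V); first by rewrite (subsetP VW) // perm_closed.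
by rewrite (out_perm sV).
Qed.

Lemma mem_Sym (T : finType) (V : {set T}) (s : {perm T}) :
  (s \in Sym V) = perm_on V s.
Proof. by rewrite inE. Qed.

Section SymSplit.
Variables (T : finType) (V D : {set T}).
Hypothesis VD : V \subset D.

Lemma Sym_mul_l (s1 s2 : {perm T}) :
  s1 \in Sym V -> s2 \in Sym (D :\: V) -> {in V, (s1 * s2)%g =1 s1}.
Proof.
rewrite !inE => s1V s2V y yV; rewrite permM (out_perm s2V) //.
by rewrite inE perm_closed // yV.
Qed.

Lemma Sym_mul_r (s1 s2 : {perm T}) :
  s1 \in Sym V -> s2 \in Sym (D :\: V) -> {in ~: V, (s1 * s2)%g =1 s2}.
Proof. by rewrite !inE => s1V s2V y; rewrite inE permM => /(out_perm s1V)->. Qed.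

(** A permutation of D that stabilises V is the product of a permutation of V and
    one of its complement in D. *)
Lemma sum_Sym_split (R : nmodType) (h : {perm T} -> R) :
  (\sum_(s in Sym D | stable s V) h s =
   \sum_(s1 in Sym V) \sum_(s2 in Sym (D :\: V)) h (s1 * s2)%g)%R.
Proof.
rewrite pair_big /=.
rewrite (reindex_onto (fun q : {perm T} * {perm T} => q.1 * q.2)%g
  (fun s => (restr_perm V s, restr_perm (D :\: V) s))) /=.
  apply: eq_bigl => -[s1 s2] /=; apply/idP/andP.
    case/andP => _ /eqP[e1 e2].
    by split; [rewrite -e1|rewrite -e2]; rewrite mem_Sym restr_perm_on.
  move=> [s1V s2V]; have s1V' := s1V; have s2V' := s2V.
  rewrite !mem_Sym in s1V' s2V'.
  have st : stable (s1 * s2)%g V.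
    by apply/stableP => y yV; rewrite (Sym_mul_l s1V s2V) // perm_closed.
  have sD : perm_on D (s1 * s2)%g.
    by apply: perm_onM; [exact: subset_trans s1V' VD|
                         exact: subset_trans s2V' (subsetDl _ _)].
  have nV : (s1 * s2)%g \in ('N(V | 'P))%g.
    by apply/astabsP => y /=; rewrite apermE stable_mem.
  have nDV : (s1 * s2)%g \in ('N(D :\: V | 'P))%g.
    by apply/astabsP => y /=; rewrite apermE !inE stable_mem // perm_closed.
  rewrite mem_Sym sD st /=; apply/eqP; congr pair; apply/permP => y.
    have [yV|yV] := boolP (y \in V).
      by rewrite restr_permE // (Sym_mul_l s1V s2V).
    by rewrite !(@out_perm _ V _ y) // restr_perm_on.
  have [yV|yV] := boolP (y \in D :\: V).
    by rewrite restr_permE // (Sym_mul_r s1V s2V) // inE; case/setDP: yV.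
  by rewrite !(@out_perm _ (D :\: V) _ y) // restr_perm_on.
move=> s /andP[]; rewrite mem_Sym => sD sV.
have nV : s \in ('N(V | 'P))%g.
  by apply/astabsP => y /=; rewrite apermE stable_mem.
have nDV : s \in ('N(D :\: V | 'P))%g.
  by apply/astabsP => y /=; rewrite apermE !inE stable_mem // perm_closed.
apply/permP => y; rewrite permM.
have [yV|yV] := boolP (y \in V).
  rewrite (restr_permE nV yV) (out_perm (restr_perm_on (D :\: V) s)) //.
  by rewrite in_setD stable_mem // yV.
rewrite (out_perm (restr_perm_on V s) yV).
have [yD|yD] := boolP (y \in D :\: V); first by rewrite restr_permE.
have yD' : y \notin D by move: yD; rewrite inE yV.
by rewrite (out_perm (restr_perm_on _ s) yD) (out_perm sD yD').
Qed.

End SymSplit.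

Section ConnectedPairs.
Variables (R : comNzRingType) (T : finType).
Implicit Types (u v : nat -> R) (s t : {perm T}) (V D : {set T}).

Definition cycle_weight u s D : R := \prod_(c in porbit s @: D) u #|c|.

Lemma cycle_weight_split u s V D : V \subset D -> stable s V ->
  cycle_weight u s D = cycle_weight u s V * cycle_weight u s (D :\: V).
Proof.
move=> VD sV; rewrite /cycle_weight (big_setID (porbit s @: V)) /=.
rewrite (setIidPr (imsetS _ VD)); congr (_ * _).
suff -> : porbit s @: D :\: porbit s @: V = porbit s @: (D :\: V) by [].
apply/setP => c; apply/setDP/imsetP => [[/imsetP[x xD ->] xV]|[x /setDP[xD xV] ->]].
  by exists x => //; rewrite inE xD andbT; apply: contra xV => /(imset_f (porbit s)).
split; first exact: imset_f.
apply/imsetP => -[y yV /eqP]; rewrite eq_porbit_mem => yx.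
by move: xV; rewrite (subsetP (stable_porbit sV yV)).
Qed.

Lemma eq_cycle_weight u s s' V : stable s V -> {in V, s =1 s'} ->
  cycle_weight u s V = cycle_weight u s' V.
Proof.
move=> sV e; rewrite /cycle_weight; suff -> : porbit s @: V = porbit s' @: V by [].
by apply: eq_in_imset => x xV; apply: eq_in_porbit e xV.
Qed.

Lemma cycle_weight_mul u s1 s2 V D : V \subset D ->
  s1 \in Sym V -> s2 \in Sym (D :\: V) ->
  cycle_weight u (s1 * s2)%g D = cycle_weight u s1 V * cycle_weight u s2 (D :\: V).
Proof.
move=> VD s1V s2V.
have e1 := Sym_mul_l s1V s2V; have e2 := Sym_mul_r s1V s2V.
move: (s1V) (s2V); rewrite !mem_Sym => s1V' s2V'.
have sV : stable s1 V by apply: perm_on_stable s1V' _.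
have sDV : stable s2 (D :\: V) by apply: perm_on_stable s2V' _.
rewrite (@cycle_weight_split _ _ V) //; last first.
  by apply/stableP => y yV; rewrite e1 // (stableP _ _ sV).
congr (_ * _); apply/esym/eq_cycle_weight => //.
  by move=> y yV; rewrite e1.
by move=> y /setDP[_ yV]; rewrite e2 // inE.
Qed.

Definition pair_sum u v D : R :=
  \sum_(s in Sym D) \sum_(t in Sym D) cycle_weight u s D * cycle_weight v t D.

Definition conn_sum u v x V : R :=
  \sum_(s in Sym V) \sum_(t in Sym V | conn_comp s t x == V)
     cycle_weight u s V * cycle_weight v t V.

Lemma eq_conn_comp s s' t t' x V : x \in V -> stable s V -> stable t V ->
  {in V, s =1 s'} -> {in V, t =1 t'} ->
  conn_comp s t x = V -> conn_comp s' t' x = V.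
Proof.
move=> xV sV tV es et cV; apply/eqP; rewrite eqEsubset; apply/andP; split.
  apply: conn_comp_min => //; apply/stableP => y yV.
    by rewrite -es // (stableP _ _ sV).
  by rewrite -et // (stableP _ _ tV).
rewrite -{1}cV; apply: subset_trans (subsetIl _ V).
have [s'C t'C] := conn_comp_stable s' t' x.
apply: conn_comp_min; first by rewrite inE conn_comp_id.
  apply/stableP => y; rewrite !inE => /andP[yC yV].
  by rewrite [s y \in V](stableP _ _ sV) // es // (stableP _ _ s'C).
apply/stableP => y; rewrite !inE => /andP[yC yV].
by rewrite [t y \in V](stableP _ _ tV) // et // (stableP _ _ t'C).
Qed.

(** The exponential formula for pairs of permutations: cutting D into the component
    of x and the rest factors the pairs and their weights. *)
Lemma pair_sum_component u v x D : x \in D ->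
  pair_sum u v D =
  \sum_(V : {set T} | (x \in V) && (V \subset D)) conn_sum u v x V * pair_sum u v (D :\: V).
Proof.
move=> xD; rewrite /pair_sum pair_big /=.
rewrite (partition_big (fun q : {perm T} * {perm T} => conn_comp q.1 q.2 x)
  (fun V => (x \in V) && (V \subset D))) /=; last first.
  case=> s t /=; rewrite !mem_Sym => /andP[sD tD].
  rewrite conn_comp_id conn_comp_min //; [exact: perm_on_stable sD _|exact: perm_on_stable tD _].
apply: eq_bigr => V /andP[xV VD].
transitivity (\sum_(s in Sym D | stable s V) \sum_(t in Sym D | stable t V)
   (if conn_comp s t x == V then cycle_weight u s D * cycle_weight v t D else 0)).
  rewrite pair_big /= big_mkcond [RHS]big_mkcond /=; apply: eq_bigr => -[s t] _ /=.
  have [cV|_] := eqVneq (conn_comp s t x) V; last by rewrite andbF if_same.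
  have [sV tV] := conn_comp_stable s t x.
  by rewrite -cV sV tV !andbT.
rewrite sum_Sym_split //=.
under eq_bigr => s1 _ do under eq_bigr => s2 _ do rewrite sum_Sym_split //.
under eq_bigr => s1 _ do rewrite exchange_big /=.
rewrite /conn_sum big_distrl /=; apply: eq_bigr => s1 s1V.
rewrite big_distrl /= big_mkcondr /=; apply: eq_bigr => t1 t1V.
have -> : (if conn_comp s1 t1 x == V then
   cycle_weight u s1 V * cycle_weight v t1 V * pair_sum u v (D :\: V) else 0) =
   \sum_(s2 in Sym (D :\: V)) \sum_(t2 in Sym (D :\: V))
   (if conn_comp s1 t1 x == V then
   (cycle_weight u s1 V * cycle_weight u s2 (D :\: V)) *
   (cycle_weight v t1 V * cycle_weight v t2 (D :\: V)) else 0).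
  case: ifP => _; last by rewrite big1 // => ? _; rewrite big1.
  rewrite /pair_sum big_distrr /=; apply: eq_bigr => s2 _.
  by rewrite big_distrr /=; apply: eq_bigr => t2 _; ring.
apply: eq_bigr => s2 s2V; apply: eq_bigr => t2 t2V.
rewrite -!cycle_weight_mul //.
move: (s1V) (t1V); rewrite !mem_Sym => s1V' t1V'.
have sV : stable s1 V by apply: perm_on_stable s1V' _.
have tV : stable t1 V by apply: perm_on_stable t1V' _.
have e1 := Sym_mul_l s1V s2V; have e2 := Sym_mul_l t1V t2V.
congr (if _ then _ else _); apply/eqP/eqP; last first.
  by apply: eq_conn_comp => // y yV; rewrite ?e1 ?e2.
apply: eq_conn_comp => //; apply/stableP => y yV.
  by rewrite e1 // (stableP _ _ sV).
by rewrite e2 // (stableP _ _ tV).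
Qed.

End ConnectedPairs.

(** A subset containing x is x together with one of the 'C(n, k) subsets of the
    n other points. *)
Lemma sum_pointed_subsets (R : nmodType) (T : finType) (x : T) (D : {set T}) n
    (F : nat -> R) : x \in D -> #|D| = n.+1 ->
  \sum_(V : {set T} | (x \in V) && (V \subset D)) F #|V| =
  \sum_(k < n.+1) F k.+1 *+ 'C(n, k).
Proof.
move=> xD cD; rewrite (reindex_onto (fun W => x |: W) (fun V => V :\ x)) /=; last first.
  by move=> V /andP[xV _]; rewrite setD1K.
have cDx : #|D :\ x| = n by move: cD; rewrite (cardsD1 x) xD => -[].
have Wb (W : {set T}) : (W \subset D :\ x -> #|W| < n.+1)%N.
  by move=> WD; rewrite ltnS -cDx subset_leq_card.
rewrite (eq_bigl (fun W : {set T} => W \subset D :\ x)); last first.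
  move=> W; rewrite setU11 /= subUset sub1set xD /= subsetD1.
  apply/idP/idP => [/andP[-> /eqP <-]|/andP[-> xW]]; first by rewrite !inE eqxx.
  by rewrite setU1K // eqxx.
rewrite (partition_big (fun W : {set T} => inord #|W| : 'I_n.+1) predT) //=.
apply: eq_bigr => k _.
have -> : 'C(n, k) = #|[set W : {set T} | W \subset D :\ x & #|W| == k]|.
  by rewrite cards_draws cDx.
rewrite -sumr_const; apply: eq_big => W.
  rewrite inE; apply/andP/andP => -[WD /eqP e]; split=> //.
    by rewrite -e inordK ?Wb.
  by apply/eqP/val_inj; rewrite /= inordK ?Wb // e.
move=> /andP[WD /eqP e]; rewrite cardsU1.
move: WD (Wb _ WD); rewrite subsetD1 => /andP[_ ->] lt.
by rewrite add1n -e inordK.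
Qed.

Section Inversion.
Variables (R : comNzRingType).

(** The exponential formula determines the connected weights from the totals: if
    the totals depend only on cardinals, so do the connected weights, and any
    numerical solution c of the recursion gives them. *)
Lemma component_weight_card (T : finType) (C : T -> {set T} -> R) (c z : nat -> R) :
  z 0%N = 1 ->
  (forall n, z n.+1 = \sum_(k < n.+1) c k.+1 * z (n - k)%N *+ 'C(n, k)) ->
  (forall x (D : {set T}), x \in D ->
     z #|D| = \sum_(V : {set T} | (x \in V) && (V \subset D)) C x V * z #|D :\: V|) ->
  forall x (V : {set T}), x \in V -> C x V = c #|V|.
Proof.
move=> z0 zrec Crec x V; have [n] := ubnP #|V|; elim: n V => // n IH V ltn xV.
have cV : #|V| = #|V|.-1.+1 by rewrite prednK //; apply/card_gt0P; exists x.
have := Crec x V xV; rewrite [in LHS]cV zrec.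
rewrite -(@sum_pointed_subsets _ _ x V #|V|.-1 (fun k => c k * z (#|V|.-1.+1 - k)%N)) //.
rewrite (bigD1 V) ?xV ?subxx //= [in RHS](bigD1 V) ?xV ?subxx //=.
rewrite -cV subnn setDv cards0 z0 !mulr1.
rewrite [X in _ + X = _](eq_bigr (fun W => C x W * z #|V :\: W|)); last first.
  move=> W /andP[/andP[xW WV] neq]; rewrite IH //.
    by rewrite (cardsD V) (setIidPr WV).
  rewrite -ltnS; apply: leq_trans ltn; rewrite ltnS proper_card //.
  by rewrite properEneq neq.
by move/addIr.
Qed.

End Inversion.

Section PermSums.
Variable R : comNzRingType.

Definition perm_sum (T : finType) (u : nat -> R) (D : {set T}) : R :=
  \sum_(s in Sym D) cycle_weight u s D.

(** With this weight on t only t = 1 contributes, so that sums over one permutation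
    become sums over pairs. *)
Definition unit_weight (k : nat) : R := (k == 1%N)%:R.

Lemma cycle_weight_unit (T : finType) (t : {perm T}) (D : {set T}) : t \in Sym D ->
  cycle_weight unit_weight t D = (t == 1%g)%:R.
Proof.
rewrite mem_Sym => tD; rewrite /cycle_weight.
have [->|t1] := eqVneq t 1%g.
  rewrite big1 // => _ /imsetP[x _ ->]; rewrite /unit_weight.
  suff -> : porbit 1 x = [set x] by rewrite cards1.
  apply/setP => y; rewrite inE; apply/porbitP/eqP => [[i ->]|->].
    by rewrite expg1n perm1.
  by exists 0%N; rewrite perm1.
have [x tx] : exists x, t x != x.
  apply/existsP; rewrite -negb_forall; apply: contra t1 => /forallP t1.
  by apply/eqP/permP => x; rewrite perm1; apply/eqP.
have xD : x \in D by apply: contraR tx => xD; rewrite (out_perm tD).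
rewrite (bigD1 (porbit t x)) ?imset_f //= /unit_weight.
suff -> : (#|porbit t x| == 1%N) = false by rewrite mul0r.
apply: contraNF tx => /cards1P[y py].
have := mem_porbit1 t x; have := porbit_id t x.
by rewrite py !inE => /eqP -> /eqP ->.
Qed.

Lemma pair_sum_unit (T : finType) u (D : {set T}) :
  pair_sum u unit_weight D = perm_sum u D.
Proof.
apply: eq_bigr => s _; rewrite -[RHS]mulr1 -big_distrr /=; congr (_ * _).
rewrite (bigD1 1%g) ?mem_Sym ?perm_on1 //= cycle_weight_unit ?mem_Sym ?perm_on1 //.
rewrite eqxx big1 ?addr0 // => t /andP[tD t1].
by rewrite cycle_weight_unit // (negPf t1).
Qed.

Lemma conn_comp1 (T : finType) (s : {perm T}) x : conn_comp s 1 x = porbit s x.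
Proof.
have st1 (W : {set T}) : stable 1 W by apply/stableP => y; rewrite perm1.
have [sC _] := conn_comp_stable s 1 x.
apply/eqP; rewrite eqEsubset stable_porbit ?conn_comp_id // andbT.
apply: conn_comp_min => //; first exact: porbit_id.
apply/stableP => y; rewrite porbit_sym -eq_porbit_mem => /eqP ->.
exact: mem_porbit1.
Qed.

Lemma conn_sum_unit (T : finType) u x (V : {set T}) :
  conn_sum u unit_weight x V = u #|V| * conn_sum (fun=> 1) unit_weight x V.
Proof.
rewrite /conn_sum big_distrr /=; apply: eq_bigr => s sV.
rewrite big_distrr /=; apply: eq_bigr => t /andP[tV /eqP cV].
rewrite cycle_weight_unit //.
have [t1|] := eqVneq t 1%g; last by rewrite !mulr0.
rewrite !mulr1 {2}/cycle_weight big1 // mulr1 /cycle_weight.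
have pV : porbit s x = V by rewrite -conn_comp1 -t1.
have -> : porbit s @: V = [set V].
  apply/setP => c; rewrite inE; apply/imsetP/eqP => [[y]|->].
    by rewrite -{1}pV -eq_porbit_mem => /eqP -> ->.
  by exists x => //; rewrite -pV porbit_id.
by rewrite big_set1.
Qed.

(** The number of cyclic orders on V, read off from the count of all permutations
    through the exponential formula. *)
Lemma card_cyclic (T : finType) x (V : {set T}) : x \in V ->
  conn_sum (fun=> 1) unit_weight x V = (#|V|.-1)`!%:R.
Proof.
have pf (D : {set T}) : perm_sum (fun=> 1) D = (#|D|`!)%:R.
  rewrite /perm_sum -card_Sym -sum1_card natr_sum.
  by apply: eq_bigr => s _; rewrite /cycle_weight big1.
move: x V; apply: (@component_weight_card R T _ (fun n => (n.-1)`!%:R) (fun n => n`!%:R)).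
- by [].
- move=> n; rewrite (eq_bigr (fun=> n`!%:R)).
    by rewrite sumr_const card_ord -mulrnA factS mulnC.
  by case=> k /= kn _; rewrite /= -natrM -mulrnA mulnC bin_fact.
- move=> x D xD; rewrite -pf -pair_sum_unit (pair_sum_component _ _ xD).
  by apply: eq_bigr => V _; rewrite pair_sum_unit pf.
Qed.

Lemma perm_sum_component (T : finType) u x (D : {set T}) : x \in D ->
  perm_sum u D = \sum_(V : {set T} | (x \in V) && (V \subset D))
     u #|V| * (#|V|.-1)`!%:R * perm_sum u (D :\: V).
Proof.
move=> xD; rewrite -pair_sum_unit (pair_sum_component _ _ xD).
by apply: eq_bigr => V /andP[xV _]; rewrite conn_sum_unit card_cyclic // pair_sum_unit.
Qed.

Lemma perm_sum0 (T : finType) u : perm_sum u (set0 : {set T}) = 1.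
Proof.
have -> : perm_sum u (set0 : {set T}) = \sum_(s in [set 1%g : {perm T}]) 1.
  rewrite /perm_sum; apply: eq_big => s.
    by rewrite mem_Sym inE; apply/idP/eqP => [/perm_on_id->|->]; rewrite ?cards0 ?perm_on1.
  by rewrite /cycle_weight imset0 big_set0.
by rewrite big_set1.
Qed.

Definition sym_sum u n : R := perm_sum u [set: 'I_n].

Lemma perm_sum_step u n :
  (forall (T : finType) (D : {set T}), (#|D| <= n)%N -> perm_sum u D = sym_sum u #|D|) ->
  forall (T : finType) (D : {set T}), #|D| = n.+1 ->
  perm_sum u D =
  \sum_(k < n.+1) u k.+1 * k`!%:R * sym_sum u (n - k)%N *+ 'C(n, k).
Proof.
move=> IH T D cD; have /card_gt0P[x xD] : (0 < #|D|)%N by rewrite cD.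
rewrite (perm_sum_component _ xD).
rewrite -(@sum_pointed_subsets _ _ x D n
  (fun k => u k * (k.-1)`!%:R * sym_sum u (n.+1 - k)%N)) //.
apply: eq_bigr => V /andP[xV VD]; have cDV : #|D :\: V| = (n.+1 - #|V|)%N.
  by rewrite cardsD (setIidPr VD) cD.
rewrite IH ?cDV // leq_subLR; have : (0 < #|V|)%N by apply/card_gt0P; exists x.
by lia.
Qed.

(** The induction runs over all ambient types at once, in order to compare the
    complements D :\: V in T with those in 'I_n. *)
Lemma perm_sumE u (T : finType) (D : {set T}) : perm_sum u D = sym_sum u #|D|.
Proof.
have [n] := ubnP #|D|; elim: n T D => // n IH T D; rewrite ltnS leq_eqVlt.
case/predU1P => [cD|]; last exact: IH.
case: n => [|n] in IH cD *.
  move/eqP: cD; rewrite cards_eq0 => /eqP ->.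
  by rewrite cards0 /sym_sum
    (_ : [set: 'I_0] = set0) ?perm_sum0 //; apply/setP => -[].
rewrite (perm_sum_step IH cD) cD; apply/esym/perm_sum_step => //.
by rewrite cardsT card_ord.
Qed.

Lemma sym_sum0 u : sym_sum u 0 = 1.
Proof. by have := perm_sumE u (set0 : {set 'I_0}); rewrite perm_sum0 cards0. Qed.

Lemma sym_sumS u n :
  sym_sum u n.+1 = \sum_(k < n.+1) u k.+1 * k`!%:R * sym_sum u (n - k)%N *+ 'C(n, k).
Proof.
by apply: perm_sum_step; [move=> T D _; apply: perm_sumE|rewrite cardsT card_ord].
Qed.

Lemma pair_sumE u v (T : finType) (D : {set T}) :
  pair_sum u v D = sym_sum u #|D| * sym_sum v #|D|.
Proof.
rewrite -!perm_sumE /pair_sum /perm_sum big_distrl /=; apply: eq_bigr => s _.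
by rewrite big_distrr.
Qed.

(** How connected sums over pairs are computed: it suffices to find numbers c
    satisfying the exponential recursion. *)
Lemma conn_sumE u v (c : nat -> R) :
  (forall n, sym_sum u n.+1 * sym_sum v n.+1 = \sum_(k < n.+1)
     c k.+1 * (sym_sum u (n - k)%N * sym_sum v (n - k)%N) *+ 'C(n, k)) ->
  forall (T : finType) x (V : {set T}), x \in V -> conn_sum u v x V = c #|V|.
Proof.
move=> crec T; apply: (@component_weight_card R T _ c (fun n => sym_sum u n * sym_sum v n)).
- by rewrite !sym_sum0 mul1r.
- exact: crec.
- move=> x D xD; rewrite -pair_sumE (pair_sum_component _ _ xD).
  by apply: eq_bigr => V _; rewrite pair_sumE.
Qed.

End PermSums.

(** * Logarithms over the partition lattice *)

Section Existence.
Variables (R : comNzRingType) (z : nat -> R).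

(** The recursion z_(n+1) = sum_k 'C(n, k) c_(k+1) z_(n-k), solved for its top
    term c_(n+1). *)
Fixpoint component_upto (n : nat) : nat -> R :=
  if n is n'.+1 then fun k => if k == n'.+1 then
    z n'.+1 - \sum_(j < n') component_upto n' j.+1 * z (n' - j)%N *+ 'C(n', j)
    else component_upto n' k
  else fun=> 0.

Lemma component_weight_exists : z 0%N = 1 ->
  exists c : nat -> R, forall n,
    z n.+1 = \sum_(k < n.+1) c k.+1 * z (n - k)%N *+ 'C(n, k).
Proof.
move=> z0; exists (fun n => component_upto n n) => n.
have stab m k : (k <= m)%N -> component_upto m k = component_upto k k.
  elim: m => [|m IH]; first by rewrite leqn0 => /eqP ->.
  rewrite leq_eqVlt => /predU1P[->//|]; rewrite ltnS => km /=.
  by rewrite ifN ?IH // neq_ltn ltnS km.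
rewrite big_ord_recr /= eqxx subnn z0 mulr1 binn mulr1n.
rewrite [X in _ = X + _](eq_bigr (fun j : 'I_n =>
  component_upto n j.+1 * z (n - j)%N *+ 'C(n, j))) ?addrNK 1?addrC ?subrK //.
by move=> j _; rewrite [component_upto n j.+1]stab.
Qed.

End Existence.

Section Partitions.
Variables (R : comNzRingType) (T : finType) (e : nat -> R).
Implicit Types (g : nat -> R) (B D V W U : {set T}) (P Q : {set {set T}}).

(** Choosing a partition and then one of its blocks is choosing the block first and
    then a partition of its complement. *)
Lemma sum_marked_block (S : nmodType) (F : {set T} -> {set {set T}} -> S) B :
  \sum_(P : {set {set T}} | partition P B) \sum_(V in P) F V (P :\ V) =
  \sum_(V : {set T} | (V != set0) && (V \subset B))
     \sum_(Q : {set {set T}} | partition Q (B :\: V)) F V Q.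
Proof.
rewrite !pair_big_dep /=.
rewrite (reindex_onto (fun q : {set T} * {set {set T}} => (q.1 |: q.2, q.1))
   (fun q => (q.2, q.1 :\ q.2))) /=; last first.
  by case=> P V /= /andP[_ VP]; rewrite setD1K.
apply: eq_big => [[V Q]|[V Q] /= /andP[_ /eqP[->]]] //=.
apply/idP/idP.
  case/andP => /andP[pP _] /eqP[QE].
  have VP : V \in V |: Q by rewrite setU11.
  rewrite (partition_neq0 pP VP) (partitionS pP VP) /=.
  by rewrite -QE; apply: partitionD1.
case/andP => /andP[V0 VB] pQ.
have VQ : V \notin Q.
  apply/negP => VQ; case/set0Pn: V0 => x xV.
  by have := subsetP (partitionS pQ VQ) x xV; rewrite !inE xV.
rewrite setU11 setU1K // eqxx !andbT -(setID B V) (setIidPr VB).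
apply: partitionU1 => //.
by rewrite -setI_eq0; apply/eqP/setP => x; rewrite !inE; case: (x \in V).
Qed.

Definition part_sum g D : R :=
  \sum_(P : {set {set T}} | partition P D) g #|P| * \prod_(V in P) e #|V|.

Lemma part_sum_marked g B :
  \sum_(P : {set {set T}} | partition P B)
     (g #|P| * \prod_(V in P) e #|V|) *+ #|P| =
  \sum_(V : {set T} | (V != set0) && (V \subset B))
     e #|V| * part_sum (g \o succn) (B :\: V).
Proof.
pose F V Q := g #|Q|.+1 * (e #|V| * \prod_(W in Q) e #|W|).
transitivity (\sum_(P : {set {set T}} | partition P B) \sum_(V in P) F V (P :\ V)).
  apply: eq_bigr => P _; rewrite -sumr_const; apply: eq_bigr => V VP.
  by rewrite /F [in LHS](big_setD1 V) //= [in LHS](cardsD1 V) VP add1n.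
rewrite sum_marked_block; apply: eq_bigr => V _.
by rewrite /part_sum big_distrr; apply: eq_bigr => Q _; rewrite /F /=; ring.
Qed.

Lemma part_sum_pointed g x B : x \in B ->
  part_sum g B = \sum_(V : {set T} | (x \in V) && (V \subset B))
     e #|V| * part_sum (g \o succn) (B :\: V).
Proof.
move=> xB; pose F V Q := if x \in V then
  g #|Q|.+1 * (e #|V| * \prod_(W in Q) e #|W|) else 0.
transitivity (\sum_(P : {set {set T}} | partition P B) \sum_(V in P) F V (P :\ V)).
  apply: eq_bigr => P pP.
  have xP : x \in cover P by rewrite (cover_partition pP).
  rewrite [RHS](bigD1 (pblock P x)) ?pblock_mem //= [X in _ + X]big1 ?addr0.
    rewrite /F mem_pblock xP [in LHS](big_setD1 (pblock P x)) ?pblock_mem //=.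
    by rewrite [in LHS](cardsD1 (pblock P x)) ?pblock_mem // add1n.
  move=> V /andP[VP neq]; rewrite /F; case: ifP => // xV.
  by rewrite (def_pblock (partition_trivIset pP) VP xV) eqxx in neq.
rewrite sum_marked_block big_mkcond [RHS]big_mkcond; apply: eq_bigr => V _.
have [xV|xV] := boolP (x \in V); last first.
  rewrite /=; case: ifP => // _; rewrite big1 // => Q _.
  by rewrite /F (negPf xV).
have -> /= : V != set0 by apply/set0Pn; exists x.
case: ifP => // _; rewrite /part_sum big_distrr; apply: eq_bigr => Q _.
by rewrite /F xV /=; ring.
Qed.

(** The values of the Moebius function of the partition lattice, in terms of the
    number of blocks.  With exponential generating functions these are the
    coefficients of log(1 + X), and [inv_coef] those of 1 / (1 + X). *)
Definition log_coef (n : nat) : R := (-1) ^+ n.-1 * (n.-1)`!%:R.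
Definition inv_coef (n : nat) : R := (-1) ^+ n * n`!%:R.

Lemma part_sum_set0 g : part_sum g set0 = g 0%N.
Proof.
rewrite /part_sum (eq_bigl (pred1 set0)) => [|P]; last by rewrite partition_set0.
by rewrite big_pred1_eq big_set0 cards0 mulr1.
Qed.

(** Multiplying 1 / E by E gives 1: for B nonempty, a pair of a partition of W and
    the nonempty complement of W is a partition of B with a marked block, and such
    terms cancel the term W = B since n (n-1)! = n!. *)
Lemma part_sum_inverse B : e 0%N = 1 ->
  \sum_(W : {set T} | W \subset B) part_sum inv_coef W * e #|B :\: W| = (B == set0)%:R.
Proof.
move=> e0; have [->|B0] := eqVneq B set0.
  rewrite (eq_bigl (pred1 set0)) => [|W]; last by rewrite subset0.
  by rewrite big_pred1_eq part_sum_set0 setDv cards0 e0 mulr1 /inv_coef mul1r.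
rewrite (bigD1 B) //= setDv cards0 e0 mulr1.
rewrite (reindex_onto (fun V => B :\: V) (fun W => B :\: W)) /=; last first.
  by move=> W /andP[WB _]; rewrite setDDr setDv set0U (setIidPr WB).
have := part_sum_marked log_coef B.
rewrite (eq_bigr (fun P : {set {set T}} =>
  - (inv_coef #|P| * \prod_(V in P) e #|V|))); last first.
  move=> P pP; have: (0 < #|P|)%N.
    rewrite lt0n cards_eq0; apply: contra B0 => /eqP P0.
    by rewrite -(cover_partition pP) P0 /cover big_set0.
  case: #|P| => // n _; rewrite /log_coef /inv_coef /= factS natrM exprS -mulr_natr.
  by ring.
rewrite sumrN => key; rewrite -[RHS](subrr (part_sum inv_coef B)) [X in _ = _ + X]key.
congr (_ + _); apply: eq_big => [V|V].
  rewrite subsetDl /=; apply/idP/idP.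
    case/andP => neq /eqP <-; rewrite setDDr setDv set0U.
    rewrite subsetIl andbT; apply: contra neq => BV.
    by apply/eqP/setDidPl; rewrite -setI_eq0.
  case/andP => V0 VB; rewrite setDDr setDv set0U (setIidPr VB) eqxx andbT.
  by apply: contra V0 => /eqP/setDidPl; rewrite -setI_eq0 (setIidPr VB).
move=> /andP[_ /eqP ->]; rewrite mulrC; congr (_ * _).
Qed.

(** The identity E' = (log E)' E.  Removing the block of x turns the logarithmic
    coefficients into those of 1 / E, and 1 / E times E is 1. *)
Lemma part_sum_exp x D : e 0%N = 1 -> x \in D ->
  e #|D| = \sum_(V : {set T} | (x \in V) && (V \subset D))
     part_sum log_coef V * e #|D :\: V|.
Proof.
move=> e0 xD.
under eq_bigr => V /andP[xV VD] do rewrite (part_sum_pointed _ xV) big_distrl /=.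
rewrite (exchange_big_dep (fun U : {set T} => (x \in U) && (U \subset D))) /=; last first.
  by move=> V U /andP[_ VD] /andP[-> UV]; rewrite (subset_trans UV).
transitivity (\sum_(U : {set T} | (x \in U) && (U \subset D))
   e #|U| * (D :\: U == set0)%:R).
  rewrite (bigD1 D) ?xD //= setDv eqxx mulr1 big1 ?addr0 // => U.
  case/andP => /andP[_ UD] neq; rewrite setD_eq0.
  case: (boolP (D \subset U)) => DU; last by rewrite mulr0.
  by move: neq; rewrite eqEsubset UD DU.
apply: eq_bigr => U /andP[xU UD]; rewrite -part_sum_inverse // big_distrr /=.
apply/esym; rewrite [RHS](reindex_onto (fun V => V :\: U) (fun W => U :|: W)) /=; last first.
  by move=> W; rewrite subsetD => /andP[_ dWU]; rewrite setDUl setDv set0U; apply/setDidPl.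
have UE V : U :|: V :\: U = U :|: V.
  by apply/setP => y; rewrite !inE; case: (y \in U).
apply: eq_big => [V|V /andP[/andP[xV VD] /andP[_ UV]]].
  rewrite UE [_ == V](sameP eqP setUidPr) [RHS]andbC xU /=.
  case: (boolP (U \subset V)) => UV; last first.
    by rewrite !andbF.
  rewrite andbT (subsetP UV) //=; apply/idP/idP => [VD|]; first exact: setSD.
  by move/(setUS U); rewrite !UE (setUidPr UV) (setUidPr UD).
rewrite mulrA; congr (_ * e #|pred_of_set _|).
by rewrite setDDl UE (setUidPr UV).
Qed.

Lemma part_sumE (c : nat -> R) : e 0%N = 1 ->
  (forall n, e n.+1 = \sum_(k < n.+1) c k.+1 * e (n - k)%N *+ 'C(n, k)) ->
  forall D, D != set0 -> part_sum log_coef D = c #|D|.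
Proof.
move=> e0 crec D /set0Pn[x xD].
apply: (@component_weight_card R T (fun=> part_sum log_coef) c e) xD => //.
by move=> y B yB; apply: part_sum_exp.
Qed.

End Partitions.

(** * Transitive pairs *)

Definition transitive_pair (T : finType) (s t : {perm T}) : bool :=
  [transitive <<[set s; t]>>, on [set: T] | 'P]%g.

Lemma transitive_pairE (T : finType) (s t : {perm T}) x :
  transitive_pair s t = (conn_comp s t x == [set: T]).
Proof.
apply/idP/eqP => [tr|cT].
  have [sC tC] := conn_comp_stable s t x.
  have G : <<[set s; t]>>%g \subset 'N(conn_comp s t x | 'P)%g.
    rewrite gen_subG; apply/subsetP => r; rewrite !inE => /orP[]/eqP->;
    by apply/subsetP => y; rewrite inE /= apermE stable_mem.
  apply/eqP; rewrite eqEsubset subsetT /= -(atransP tr x (in_setT x)).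
  by rewrite acts_sub_orbit // conn_comp_id.
apply/imsetP; exists x; rewrite // -cT; apply/eqP; rewrite eqEsubset cT subsetT andbT -cT.
apply: conn_comp_min; first exact: orbit_refl.
  apply/stableP => y /orbitP[r rG <-]; apply/orbitP; exists (r * s)%g.
    by rewrite groupM // mem_gen // !inE eqxx.
  by rewrite /= !apermE permM.
apply/stableP => y /orbitP[r rG <-]; apply/orbitP; exists (r * t)%g.
  by rewrite groupM // mem_gen // !inE eqxx orbT.
by rewrite /= !apermE permM.
Qed.

Lemma transitive_pairM (T : finType) (s t : {perm T}) :
  transitive_pair s (s * t)%g = transitive_pair s t.
Proof.
rewrite /transitive_pair; congr (_ \in _).
suff -> : <<[set s; (s * t)%g]>>%g = <<[set s; t]>>%g by [].
apply/eqP; rewrite eqEsubset !gen_subG; apply/andP; split; apply/subsetP => r;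
  rewrite !inE => /orP[]/eqP->.
- by rewrite mem_gen // !inE eqxx.
- by apply: groupM; apply: mem_gen; rewrite !inE eqxx ?orbT.
- by rewrite mem_gen // !inE eqxx.
- have {1}-> : t = (s^-1 * (s * t))%g by rewrite mulKg.
  apply: groupM; rewrite ?groupV; apply: mem_gen;
  by rewrite !inE eqxx ?orbT.
Qed.

Lemma card_porbits_gt0 (T : finType) (s : {perm T}) (x : T) : (0 < #|porbits s|)%N.
Proof. by apply/card_gt0P; exists (porbit s x); apply: imset_f. Qed.

(** An invariant function of a transitive pair is constant. *)
Lemma genus_bound (T : finType) (s t : {perm T}) : (0 < #|T|)%N ->
  transitive_pair s t ->
  (#|porbits s| + #|porbits t| + #|porbits (s * t)%g| <= #|T|.+2)%N.
Proof.
move=> /card_gt0P[x _] tr; have [f [fs ft le]] := genus_bound_label s t.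
apply: leq_trans le _; rewrite -[_.+2]addn2 leq_add2l.
suff: (#|f @: setT| <= 1)%N by rewrite -addnn; lia.
rewrite -(cards1 (f x)) subset_leq_card //; apply/subsetP => A /imsetP[y _ ->].
rewrite inE; apply/eqP.
have : y \in conn_comp s t x by have := tr; rewrite (transitive_pairE _ _ x) => /eqP ->; rewrite inE.
move=> /conn_compP/(_ [set z | f z == f x]); rewrite !inE eqxx => h; apply/eqP/h => //.
  by apply/stableP => z; rewrite !inE fs.
by apply/stableP => z; rewrite !inE ft.
Qed.

Lemma connected_bound (T : finType) (s t : {perm T}) : (0 < #|T|)%N ->
  transitive_pair s t -> (#|porbits s| + #|porbits t| <= #|T|.+1)%N.
Proof.
move=> T0 tr; have := genus_bound T0 tr; case/card_gt0P: T0 => x _.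
have := card_porbits_gt0 (s * t)%g x; lia.
Qed.

(** The genus bound leaves at most two cycles for s * t, and the signs of s, t and
    s * t exclude one. *)
Lemma annular_two_cycles (T : finType) (s t : {perm T}) : (0 < #|T|)%N ->
  transitive_pair s t -> (#|porbits s| + #|porbits t| = #|T|)%N ->
  #|porbits (s * t)%g| = 2%N.
Proof.
move=> T0 tr e; have := genus_bound T0 tr; rewrite e -addn2 leq_add2l.
have := odd_permM s t; rewrite /odd_perm -e oddD.
have := card_porbits_gt0 (s * t)%g; case/card_gt0P: T0 => x _ /(_ x).
case: #|porbits (s * t)| => [|[|[|m]]] //= _; 
by case: (odd _) => //; case: (odd _).
Qed.

Lemma porbit_fiber (T : finType) (s : {perm T}) x :
  [set y | porbit s y == porbit s x] = porbit s x.
Proof. by apply/setP => y; rewrite inE eq_porbit_mem. Qed.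

Lemma sum_porbits (R : nmodType) (T : finType) (s : {perm T}) (F : {set T} -> R) :
  \sum_(x : T) F (porbit s x) = \sum_(c in porbits s) F c *+ #|c|.
Proof.
rewrite (partition_big_imset (porbit s)) /=; apply: eq_bigr => _ /imsetP[x _ ->].
rewrite (eq_bigr (fun=> F (porbit s x))) => [|y /eqP -> //].
rewrite sumr_const; congr (_ *+ _); rewrite -[in RHS](porbit_fiber s x).
by rewrite cardsE.
Qed.

Lemma card_porbits_sum (T : finType) (s : {perm T}) :
  (\sum_(c in porbits s) #|c| = #|T|)%N.
Proof.
have := sum_porbits s (fun=> 1%N); rewrite sum1_card => ->.
by apply: eq_bigr => c _; elim: #|c| => // n; rewrite mulrS => <-.
Qed.

Lemma cycle_weightT (R : comNzRingType) (T : finType) (u : nat -> R) (s : {perm T}) :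
  cycle_weight u s setT = \prod_(c in porbits s) u #|c|.
Proof.
rewrite /cycle_weight; suff -> : porbit s @: setT = porbits s by [].
by apply/setP => A; apply/imsetP/imsetP => -[x _ ->]; exists x.
Qed.

(** Geometric factors in the cycle weights only see the length n - |s| of s. *)
Lemma cycle_weight_exp (R : comNzRingType) (T : finType) (a : nat -> R) (b : R)
    (s : {perm T}) :
  cycle_weight (fun k => a k * b ^+ k.-1) s setT =
  \prod_(c in porbits s) a #|c| * b ^+ (#|T| - #|porbits s|).
Proof.
rewrite cycle_weightT big_split /=; congr (_ * _).
rewrite prodrXr; congr (_ ^+ _); apply/esym/eqP.
rewrite -(eqn_add2r #|porbits s|) subnK ?card_porbits_le //.
rewrite -[X in (_ == _ + X)%N]sum1_card -big_split /= -(card_porbits_sum s); apply/eqP.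
apply: eq_bigr => _ /imsetP[x _ ->]; rewrite addn1 prednK // lt0n.
exact: card_porbit_neq0.
Qed.

Section Expansion.
Variable (R : fieldType).
Implicit Types (kappa : nat -> R).

(** The exponent of -1/D with which a transitive pair enters the moments. *)
Definition genus_defect (T : finType) (s t : {perm T}) : nat :=
  (#|T|.+1 - #|porbits s| - #|porbits t|)%N.

Definition orbit_prod (T : finType) kappa (s : {perm T}) : R :=
  \prod_(c in porbits s) kappa #|c|.

Lemma conn_sum_genus (D : R) kappa n : D != 0 ->
  (-1) ^+ n / D * conn_sum (fun k => kappa k * (- D^-1) ^+ k.-1)
    (fun k => D * (-1) ^+ k.-1) ord0 [set: 'I_n.+1] =
  \sum_(s : 'S_n.+1) \sum_(t : 'S_n.+1 | transitive_pair s t)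
    (- D^-1) ^+ genus_defect s t * orbit_prod kappa s.
Proof.
move=> D0; rewrite /conn_sum big_distrr /=; apply: eq_big => [s|s _].
  by rewrite mem_Sym; apply/subsetP => x; rewrite inE.
rewrite big_distrr /=; apply: eq_big => [t|t /andP[_ cst]].
  rewrite mem_Sym -transitive_pairE; case: transitive_pair; rewrite ?andbF ?andbT //.
  by apply/subsetP => x; rewrite inE.
rewrite -transitive_pairE in cst.
have cT : #|'I_n.+1| = n.+1 by rewrite card_ord.
have := connected_bound (_ : 0 < #|'I_n.+1|)%N cst; rewrite cT => /(_ isT) le.
rewrite !cycle_weight_exp prodr_const /genus_defect cT -/(orbit_prod kappa s).
have [ls lt] := (card_porbits_le s, card_porbits_le t); rewrite !cT in ls lt.
set a := #|porbits s| in le ls *; set b := #|porbits t| in le lt *.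
(* In terms of e = -1/D the signs occur in pairs. *)
set e := - D^-1; have e0 : e != 0 by rewrite oppr_eq0 invr_eq0.
have De : D = - e^-1 by rewrite /e invrN opprK invrK.
clearbody e.
have sgE : (-1) ^+ (n.+1 - b) * (-1) ^+ b = (-1) ^+ n.+1 :> R by rewrite -exprD subnK.
have eE : e ^+ (n.+2 - a - b) * e ^+ b = e * e ^+ (n.+1 - a).
  by rewrite -exprS -exprD; congr (_ ^+ _); lia.
apply: (mulIf (expf_neq0 b e0)); rewrite [RHS]mulrAC eE.
rewrite De; have -> : (- e^-1) ^+ b = (-1) ^+ b * (e ^+ b)^-1.
  by rewrite -exprVn -exprMn mulN1r.
have eb0 := expf_neq0 b e0; move: (e ^+ b) (e ^+ (n.+1 - a)) eb0 => eb ea eb0.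
have sq : (-1) ^+ n * (-1) ^+ n = 1 :> R by rewrite -signr_odd; case: odd; ring.
transitivity ((-1) ^+ n * - e * (orbit_prod kappa s * ea * ((-1) ^+ (n.+1 - b) * (-1) ^+ b))).
  move: ((-1) ^+ n) ((-1) ^+ b) ((-1) ^+ (n.+1 - b)) (orbit_prod _ _) => x y z w.
  by field; rewrite ?eb0 ?e0 ?oppr_eq0 ?oner_eq0.
transitivity ((-1) ^+ n * - e * (orbit_prod kappa s * ea * (-1) ^+ n.+1)).
  by congr (_ * (_ * _)); exact: sgE.
rewrite exprS.
transitivity (((-1) ^+ n * (-1) ^+ n) * (e * ea * orbit_prod kappa s)); first by ring.
by rewrite sq mul1r.
Qed.

End Expansion.

(** * Permutations with two cycles *)

Lemma conjgE_perm (T : finType) (g s : {perm T}) x : (s ^ g)%g (g x) = g (s x).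
Proof. by rewrite /conjg !permM permK. Qed.

Section Conjugation.
Variables (T : finType) (g : {perm T}).
Implicit Types s t : {perm T}.

Lemma porbitJ s x : porbit (s ^ g)%g (g x) = g @: porbit s x.
Proof.
apply/setP => y; apply/porbitP/imsetP => [[i ->]|[z /porbitP[i ->] ->]].
  by exists ((s ^+ i)%g x); rewrite ?mem_porbit // -conjXg conjgE_perm.
by exists i; rewrite -conjXg conjgE_perm.
Qed.

Lemma porbitsJ s : porbits (s ^ g)%g = (fun c : {set T} => g @: c) @: porbits s.
Proof.
apply/setP => A; apply/imsetP/imsetP => [[x _ ->]|[_ /imsetP[x _ ->] ->]].
  by exists (porbit s (g^-1 x)%g); rewrite ?imset_f // -porbitJ permKV.
by exists (g x); rewrite ?porbitJ.
Qed.

Lemma card_porbitsJ s : #|porbits (s ^ g)%g| = #|porbits s|.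
Proof. by rewrite porbitsJ card_imset //; apply/imset_inj/perm_inj. Qed.

Lemma orbit_prodJ (R : fieldType) (kappa : nat -> R) s :
  orbit_prod kappa (s ^ g)%g = orbit_prod kappa s.
Proof.
rewrite /orbit_prod porbitsJ big_imset /=.
  by apply: eq_bigr => c _; rewrite card_imset //; apply: perm_inj.
by move=> A B _ _; apply/imset_inj/perm_inj.
Qed.

Lemma transitive_pairJ s t :
  transitive_pair (s ^ g)%g (t ^ g)%g = transitive_pair s t.
Proof.
suff H (h : {perm T}) s' t' : transitive_pair s' t' -> transitive_pair (s' ^ h)%g (t' ^ h)%g.
  apply/idP/idP => [/(H g^-1%g)|]; last exact: H.
  by rewrite !conjgK.
move=> tr; have /imsetP[x _ _] := tr.
move: tr; rewrite (transitive_pairE _ _ x) (transitive_pairE _ _ (h x)) => /eqP cT.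
apply/eqP/setP => y; rewrite in_setT; apply/conn_compP => W xW sW tW.
have : (h^-1)%g y \in conn_comp s' t' x by rewrite cT inE.
move=> /conn_compP/(_ [set z | h z \in W]); rewrite !inE permKV; apply=> //.
  by apply/stableP => z; rewrite !inE -conjgE_perm => /(stableP _ _ sW).
by apply/stableP => z; rewrite !inE -conjgE_perm => /(stableP _ _ tW).
Qed.

End Conjugation.

(** A permutation with exactly two cycles, of lengths t and s, with a point chosen
    on each.  Marking both cycles removes all symmetries, so that such data are
    exactly the relabelings of the standard permutation. *)
Definition marked_two_cycles (T : finType) (t s : nat) (p : {perm T} * T * T) : bool :=
  let: (r, x, y) := p in
  [&& #|porbits r| == 2%N, y \notin porbit r x, #|porbit r x| == t & #|porbit r y| == s].

Lemma porbits_setU (T : finType) (r : {perm T}) x y :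
  #|porbits r| = 2%N -> y \notin porbit r x -> porbit r x :|: porbit r y = setT.
Proof.
move=> c2 yx; have xy : porbit r x != porbit r y by rewrite eq_porbit_mem porbit_sym.
have E : porbits r = [set porbit r x; porbit r y].
  apply/eqP; rewrite eq_sym eqEcard cards2 xy c2 leqnn andbT.
  by apply/subsetP => c; rewrite !inE => /orP[]/eqP->; apply: imset_f.
apply/setP => z; rewrite !inE; have : porbit r z \in porbits r by apply: imset_f.
by rewrite E !inE !eq_porbit_mem.
Qed.

Section TwoCycles.
Variables (t s : nat) (t0 : (0 < t)%N) (s0 : (0 < s)%N).
Local Notation gam := (two_cycles t s).
Let i0 : 'I_(t + s) := lshift s (Ordinal t0).
Let i1 : 'I_(t + s) := rshift t (Ordinal s0).

Lemma two_cycles_l (j : 'I_t) : gam (lshift s j) = lshift s (ordS j).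
Proof. by rewrite permE /two_cycles_fun (unsplitK (inl j)). Qed.

Lemma two_cycles_r (j : 'I_s) : gam (rshift t j) = rshift t (ordS j).
Proof. by rewrite permE /two_cycles_fun (unsplitK (inr j)). Qed.

Lemma two_cycles_iter_l (j : 'I_t) : (gam ^+ j)%g i0 = lshift s j.
Proof.
case: j => j; elim: j => [|j IH] jt; first by rewrite expg0 perm1; congr lshift; apply: val_inj.
rewrite /= expgSr permM (IH (ltnW jt)) two_cycles_l; congr lshift; apply: val_inj.
by rewrite /= modn_small.
Qed.

Lemma two_cycles_iter_r (j : 'I_s) : (gam ^+ j)%g i1 = rshift t j.
Proof.
case: j => j; elim: j => [|j IH] js; first by rewrite expg0 perm1; congr rshift; apply: val_inj.
rewrite /= expgSr permM (IH (ltnW js)) two_cycles_r; congr rshift; apply: val_inj.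
by rewrite /= modn_small.
Qed.

Lemma porbit_two_cycles_l : porbit gam i0 = [set lshift s j | j : 'I_t].
Proof.
apply/eqP; rewrite eqEsubset; apply/andP; split.
  apply: stable_porbit; last exact: imset_f.
  by apply/stableP => _ /imsetP[j _ ->]; rewrite two_cycles_l imset_f.
by apply/subsetP => _ /imsetP[j _ ->]; rewrite -two_cycles_iter_l mem_porbit.
Qed.

Lemma porbit_two_cycles_r : porbit gam i1 = [set rshift t j | j : 'I_s].
Proof.
apply/eqP; rewrite eqEsubset; apply/andP; split.
  apply: stable_porbit; last exact: imset_f.
  by apply/stableP => _ /imsetP[j _ ->]; rewrite two_cycles_r imset_f.
by apply/subsetP => _ /imsetP[j _ ->]; rewrite -two_cycles_iter_r mem_porbit.
Qed.

Lemma marked_two_cycles_gam : marked_two_cycles t s (gam, i0, i1).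
Proof.
have ni : i1 \notin porbit gam i0.
  by rewrite porbit_two_cycles_l; apply/imsetP => -[j _ /eqP]; rewrite eq_rlshift.
rewrite /marked_two_cycles ni porbit_two_cycles_l porbit_two_cycles_r.
rewrite (card_imset _ (@lshift_inj t s)) (card_imset _ (@rshift_inj t s)).
rewrite !card_ord !eqxx !andbT.
have -> : porbits gam = [set porbit gam i0; porbit gam i1].
  apply/setP => c; rewrite !inE; apply/imsetP/orP => [[x _ ->]|].
    by case: (split_ordP x) => j ->; [left|right]; rewrite eq_porbit_mem
      -?two_cycles_iter_l -?two_cycles_iter_r mem_porbit.
  by case=> /eqP ->; [exists i0|exists i1].
by rewrite cards2 eq_porbit_mem porbit_sym ni.
Qed.

Lemma marked_two_cyclesJ (T : finType) (g r : {perm T}) x y :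
  marked_two_cycles t s ((r ^ g)%g, g x, g y) = marked_two_cycles t s (r, x, y).
Proof.
rewrite /marked_two_cycles card_porbitsJ !porbitJ !(card_imset _ (@perm_inj _ g)).
by rewrite (mem_imset _ _ (@perm_inj _ g)).
Qed.

(** The relabeling that carries the standard permutation to r and its two base
    points to x and y: follow the cycles of r from these points. *)
Definition spread (r : 'S_(t + s)) (x y i : 'I_(t + s)) : 'I_(t + s) :=
  match fintype.split i with inl j => (r ^+ j)%g x | inr k => (r ^+ k)%g y end.

Lemma porbit_exp_inj (T : finType) (r : {perm T}) x i j :
  (i < #|porbit r x|)%N -> (j < #|porbit r x|)%N ->
  (r ^+ i)%g x = (r ^+ j)%g x -> i = j.
Proof.
move=> ilt jlt; rewrite !permX => e; apply/eqP.
rewrite -(nth_uniq x _ _ (uniq_traject_porbit r x)) ?size_traject //.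
by rewrite !nth_traject // e.
Qed.

Lemma spread_inj r x y : marked_two_cycles t s (r, x, y) -> injective (spread r x y).
Proof.
case/and4P => _ yx /eqP ct /eqP cs i j; rewrite /spread.
case: (split_ordP i) => a ->; case: (split_ordP j) => b -> e.
- by congr lshift; apply/val_inj/(porbit_exp_inj _ _ e); rewrite ct.
- case/negP: yx; rewrite -eq_porbit_mem -(porbit_perm r b) -e porbit_perm //.
- case/negP: yx; rewrite -eq_porbit_mem -(porbit_perm r a) e porbit_perm //.
- by congr rshift; apply/val_inj/(porbit_exp_inj _ _ e); rewrite cs.
Qed.

Lemma spread_conj r x y (m : marked_two_cycles t s (r, x, y)) :
  let g := perm (spread_inj m) in [/\ (gam ^ g)%g = r, g i0 = x & g i1 = y].
Proof.
move=> g; have gl (j : 'I_t) : g (lshift s j) = (r ^+ j)%g x.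
  by rewrite permE /spread (unsplitK (inl j)).
have gr (j : 'I_s) : g (rshift t j) = (r ^+ j)%g y.
  by rewrite permE /spread (unsplitK (inr j)).
case/and4P: (m) => _ _ /eqP ct /eqP cs.
have per z m' n : #|porbit r z| = m' -> (r ^+ (n %% m'))%g z = (r ^+ n)%g z.
  move=> <-; rewrite {2}(divn_eq n #|porbit r z|) expgD permM; congr ((r ^+ _)%g _).
  rewrite mulnC expgM permX.
  elim: (n %/ _)%N => //= k <-; rewrite permX iter_porbit //.
have px n : (r ^+ (n %% t))%g x = (r ^+ n)%g x by apply: per.
have py n : (r ^+ (n %% s))%g y = (r ^+ n)%g y by apply: per.
split; first 1 last.
- by rewrite gl expg0 perm1.
- by rewrite gr expg0 perm1.
apply/permP => z; rewrite -[z](permKV g) conjgE_perm; move: (g^-1 z)%g => i.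
case: (split_ordP i) => j ->.
  by rewrite two_cycles_l !gl /= px expgSr permM.
by rewrite two_cycles_r !gr /= py expgSr permM.
Qed.

(** Relabelings g correspond bijectively to marked permutations, since conjugation
    by g and the images of the two base points determine g. *)
Lemma sum_marked_two_cycles (R : nmodType) (F : 'S_(t + s) -> R) :
  (forall r g, F (r ^ g)%g = F r) ->
  \sum_(p : 'S_(t + s) * 'I_(t + s) * 'I_(t + s) | marked_two_cycles t s p) F p.1.1 =
  F gam *+ (t + s)`!.
Proof.
move=> FJ; pose h (g : 'S_(t + s)) := ((gam ^ g)%g, g i0, g i1).
have hinj : injective h.
  move=> g g' [e e0 e1]; apply/permP => i.
  have ex (z : 'I_(t+s)) n : g z = g' z -> g ((gam ^+ n)%g z) = g' ((gam ^+ n)%g z).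
    by move=> ez; rewrite -(conjgE_perm g) -(conjgE_perm g') !conjXg e ez.
  by case: (split_ordP i) => j ->; rewrite -?two_cycles_iter_l -?two_cycles_iter_r; apply: ex.
transitivity (\sum_(p in h @: [set: 'S_(t + s)]) F p.1.1).
  apply: eq_bigl => -[[r x] y]; apply/idP/imsetP => [m|[g _ [-> -> ->]]].
    have [e1 e2 e3] := spread_conj m.
    by exists (perm (spread_inj m)) => //; rewrite /h e1 e2 e3.
  by rewrite marked_two_cyclesJ marked_two_cycles_gam.
rewrite big_imset /=; last by move=> g g' _ _; apply: hinj.
rewrite (eq_bigr (fun=> F gam)) => [|g _]; last by rewrite FJ.
by rewrite sumr_const cardsT card_Sn.
Qed.

End TwoCycles.

Section AnnularCount.
Variable R : numFieldType.
Implicit Types (kappa : nat -> R).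

Definition annular_sum (T : finType) kappa (p : {perm T}) : R :=
  \sum_(s : {perm T} | transitive_pair s p &&
      (#|porbits s| + #|porbits (s^-1 * p)%g| == #|T|)%N) orbit_prod kappa s.

Lemma annular_sumJ (T : finType) kappa (p g : {perm T}) :
  annular_sum kappa (p ^ g)%g = annular_sum kappa p.
Proof.
rewrite /annular_sum (reindex_inj (@conjg_inj _ g)) /=.
apply: eq_big => s; last by rewrite orbit_prodJ.
by rewrite transitive_pairJ -conjVg -conjMg !card_porbitsJ.
Qed.

(** Change variables from t to p = s * t, which generates the same group with s. *)
Lemma sum_annular_pairs (T : finType) kappa : (0 < #|T|)%N ->
  \sum_(s : {perm T}) \sum_(t : {perm T} | transitive_pair s t &&
      (#|porbits s| + #|porbits t| == #|T|)%N) orbit_prod kappa s =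
  \sum_(p : {perm T} | #|porbits p| == 2%N) annular_sum kappa p.
Proof.
move=> T0; rewrite /annular_sum [RHS](exchange_big_dep predT) //=; apply: eq_bigr => s _.
rewrite (reindex_inj (mulgI s^-1)%g) /= big_mkcond [RHS]big_mkcond.
apply: eq_bigr => p _.
have -> : transitive_pair s (s^-1 * p)%g = transitive_pair s p.
  by rewrite -[RHS](transitive_pairM s) -(transitive_pairM s (s^-1 * p)) mulKVg transitive_pairM.
case: (boolP (transitive_pair s p)) => [tr|]; last by rewrite andbF.
case: eqP => e; rewrite /= ?andbT ?andbF //=.
have := annular_two_cycles T0 _ e; rewrite mulKVg => -> //.
by rewrite -(transitive_pairM s) mulKVg.
Qed.

(** Each of the two ordered pairs of distinct cycles receives total weight 1. *)
Lemma sum_distinct_cycles (T : finType) (p : {perm T}) : #|porbits p| = 2%N ->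
  \sum_(x : T) \sum_(y : T | y \notin porbit p x)
     (#|porbit p x|%:R * #|porbit p y|%:R)^-1 = 2 :> R.
Proof.
move=> c2; have pos x : #|porbit p x|%:R != 0 :> R.
  by rewrite pnatr_eq0 card_porbit_neq0.
rewrite (eq_bigr (fun x => (fun c : {set T} => #|c|%:R^-1) (porbit p x))).
  rewrite (@sum_porbits R _ _ (fun c : {set T} => #|c|%:R^-1)).
  rewrite (eq_bigr (fun=> 1)) => [|_ /imsetP[x _ ->]]; last by rewrite -[LHS]mulr_natl /= mulfV.
  by rewrite sumr_const c2.
move=> x _; rewrite big_mkcond /=.
pose F (c : {set T}) : R := if c == porbit p x then 0 else (#|porbit p x|%:R * #|c|%:R)^-1.
rewrite (eq_bigr (fun y => F (porbit p y))); last first.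
  by move=> y _; rewrite /F eq_porbit_mem; case: (y \in _).
rewrite sum_porbits (bigD1 (porbit p x)) ?imset_f //= {1}/F eqxx mul0rn add0r.
rewrite (eq_bigr (fun=> #|porbit p x|%:R^-1)).
  rewrite sumr_const; have -> : #|[pred c in porbits p | c != porbit p x]| = 1%N.
    have := c2; rewrite (cardD1 (porbit p x)) imset_f // add1n => -[] <-.
    by apply: eq_card => c; rewrite !inE andbC.
  by [].
move=> _ /andP[/imsetP[y _ ->] neq]; rewrite /F (negPf neq) -[LHS]mulr_natr invfM.
by rewrite mulfVK.
Qed.

(** Averaging over the two base points: the factor 2 accounts for the order of the
    two cycles, the product of the lengths for the choice of the points. *)
Lemma sum_two_cycle_perms (T : finType) n (F : {perm T} -> R) : #|T| = n ->
  \sum_(p : {perm T} | #|porbits p| == 2%N) F p =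
  \sum_(t < n.+1) \sum_(s < n.+1 | [&& 0 < t, 0 < s & t + s == n]%N)
    (\sum_(q : {perm T} * T * T | marked_two_cycles t s q) F q.1.1) / (2 * (t%:R * s%:R)).
Proof.
move=> cT.
pose w (q : {perm T} * T * T) : R :=
  (2 * (#|porbit q.1.1 q.1.2|%:R * #|porbit q.1.1 q.2|%:R))^-1.
pose good (q : {perm T} * T * T) := (#|porbits q.1.1| == 2%N) && (q.2 \notin porbit q.1.1 q.1.2).
transitivity (\sum_(q | good q) F q.1.1 * w q).
  transitivity (\sum_(p : {perm T} | #|porbits p| == 2%N)
     \sum_(x : T) \sum_(y | y \notin porbit p x) F p * w (p, x, y)).
    apply: eq_bigr => p /eqP c2; under eq_bigr do rewrite -big_distrr.
    rewrite -big_distrr /= /w /=.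
    rewrite (eq_bigr (fun x => 2^-1 * \sum_(y | y \notin porbit p x)
       (#|porbit p x|%:R * #|porbit p y|%:R)^-1)).
      by rewrite -big_distrr /= sum_distinct_cycles // mulVf ?mulr1 // pnatr_eq0.
    by move=> x _; rewrite big_distrr /=; apply: eq_bigr => y _; rewrite invfM.
  rewrite pair_big pair_big_dep /=; apply: eq_big => -[[p x] y] //=.
  by rewrite /good /= andbT.
pose sz (q : {perm T} * T * T) : 'I_n.+1 * 'I_n.+1 :=
  (inord #|porbit q.1.1 q.1.2|, inord #|porbit q.1.1 q.2|).
have szE (A : {set T}) : (inord #|A| : 'I_n.+1) = #|A| :> nat.
  by rewrite inordK // ltnS -cT max_card.
rewrite (partition_big sz (fun ts : 'I_n.+1 * 'I_n.+1 =>
   [&& 0 < ts.1, 0 < ts.2 & ts.1 + ts.2 == n]%N)) /=; last first.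
  case=> [[p x] y] /= /andP[/= /eqP c2 yx]; rewrite !szE !lt0n !card_porbit_neq0 /=.
  rewrite -cT -cardsT -(porbits_setU c2 yx) cardsU.
  suff -> : porbit p x :&: porbit p y = set0 by rewrite cards0 subn0.
  apply/setP => z; rewrite !inE; apply/negP => /andP[]; rewrite -!eq_porbit_mem.
  by move=> /eqP -> /eqP exy; move: yx; rewrite -eq_porbit_mem exy eqxx.
rewrite [RHS]pair_big_dep /=; apply: eq_big => [[t s] //|[t s] /= ts].
rewrite big_distrl /=; apply: eq_big => [[[p x] y]|[[p x] y]] /=.
  rewrite /good /marked_two_cycles /= -andbA; congr (_ && (_ && _)).
  rewrite /sz xpair_eqE /= -!val_eqE /= !szE //.
by move=> /andP[_ /eqP [<- <-]]; rewrite /w /= !szE.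
Qed.

End AnnularCount.

(** * Non-crossing partitions *)

(* [lia] is very slow in contexts with many hypotheses about finite sets. *)
Ltac order_lia :=
  repeat match goal with H : ?T |- _ =>
    lazymatch T with
    | is_true (leq _ _) => fail
    | @eq nat _ _ => fail
    | is_true (andb (leq _ _) (leq _ _)) => fail
    | _ => clear H
    end end; lia.

Section NonCrossing.
Variables (R : comNzRingType) (N : nat) (u : nat -> R).
Implicit Types (D V W B : {set 'I_N}) (P Q : {set {set 'I_N}}) (x y : 'I_N).

Lemma noncrossingP P : reflect
  (forall V W (i j k l : 'I_N), V \in P -> W \in P ->
     i \in V -> j \in W -> k \in V -> l \in W -> (i < j < k)%N -> (k < l)%N -> V = W)
  (noncrossing P).
Proof.
apply: (iffP idP) => [nc V W i j k l VP WP iV jW kV lW /andP[ij jk] kl|nc].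
  move/forall_inP: nc => /(_ V VP) /forall_inP/(_ W WP) /forall_inP/(_ i iV).
  move=> /forall_inP/(_ j jW) /forall_inP/(_ k kV) /forall_inP/(_ l lW).
  by rewrite ij jk kl => /eqP.
apply/forall_inP => V VP; apply/forall_inP => W WP; apply/forall_inP => i iV.
apply/forall_inP => j jW; apply/forall_inP => k kV; apply/forall_inP => l lW.
apply/implyP => /andP[/andP[ij jk] kl].
by apply/eqP/(nc V W i j k l) => //; apply/andP.
Qed.

Definition nc_sum D : R :=
  \sum_(P : {set {set 'I_N}} | partition P D && noncrossing P) \prod_(V in P) u #|V|.

(** The non-crossing sum in which the block of x counts as having k more points.
    Shifting one weight is what makes it possible to remove points one at a
    time. *)
Definition nc_sum_pointed (k : nat) x D : R :=
  \sum_(P : {set {set 'I_N}} | partition P D && noncrossing P)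
    u (#|pblock P x| + k)%N * \prod_(V in P :\ pblock P x) u #|V|.

Lemma nc_sum_pointed0 x D : x \in D -> nc_sum D = nc_sum_pointed 0 x D.
Proof.
move=> xD; apply: eq_bigr => P /andP[pP _].
by rewrite (big_setD1 (pblock P x)) ?pblock_mem ?(cover_partition pP) // addn0.
Qed.

Lemma nc_sum_set0 : nc_sum set0 = 1.
Proof.
rewrite /nc_sum (eq_bigl (pred1 set0)) => [|P]; first by rewrite big_pred1_eq big_set0.
rewrite partition_set0 /=; case: eqP => //= ->.
by apply/noncrossingP => V W i j k l; rewrite inE.
Qed.

(** No block straddles the gap just after y. *)
Definition split_at y P : bool :=
  [forall V in P, (V \subset [set i : 'I_N | (i <= y)%N]) || (V \subset [set i : 'I_N | (y < i)%N])].

Lemma split_atP y P : reflect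
  (forall V, V \in P -> {in V, forall i : 'I_N, (i <= y)%N} \/ {in V, forall i : 'I_N, (y < i)%N})
  (split_at y P).
Proof.
apply: (iffP forall_inP) => h V /h.
  by case/orP => /subsetP sV; [left|right] => i /sV; rewrite inE.
by case=> sV; apply/orP; [left|right]; apply/subsetP => i /sV; rewrite inE.
Qed.

Lemma partition_restrict P D (E : {set 'I_N}) : partition P D -> E \subset D ->
  (forall V, V \in P -> V \subset E \/ [disjoint V & E]) ->
  partition [set V in P | V \subset E] E.
Proof.
move=> pP ED h; apply/and3P; split.
- apply/eqP/setP => i; apply/bigcupP/idP => [[V]|iE].
    by rewrite inE => /andP[_ /subsetP VE] /VE.
  have ic : i \in cover P by rewrite (cover_partition pP) (subsetP ED).
  exists (pblock P i); last by rewrite mem_pblock.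
  rewrite inE pblock_mem //=; case: (h _ (pblock_mem ic)) => // dis.
  by have := disjointFr dis (_ : i \in pblock P i); rewrite mem_pblock ic iE => /(_ isT).
- apply/trivIsetP => V W; rewrite !inE => /andP[VP _] /andP[WP _].
  exact: (trivIsetP (partition_trivIset pP)).
- by rewrite inE (partition0 pP).
Qed.

(** A non-crossing partition that splits after y is a pair of non-crossing
    partitions, of the points up to y and of the points beyond y. *)
Lemma nc_sum_split k y D : y \in D ->
  \sum_(P : {set {set 'I_N}} | [&& partition P D, noncrossing P & split_at y P])
    u (#|pblock P y| + k)%N * \prod_(V in P :\ pblock P y) u #|V| =
  nc_sum_pointed k y [set i in D | (i <= y)%N] * nc_sum [set i in D | (y < i)%N].
Proof.
move=> yD; set D1 := [set i in D | _]; set D2 := [set i in D | _].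
have DE : D1 :|: D2 = D.
  by apply/setP => i; rewrite !inE -andb_orr leqNgt; case: ltnP; rewrite ?andbT.
have dis : [disjoint D1 & D2].
  rewrite -setI_eq0; apply/eqP/setP => i; rewrite !inE leqNgt.
  by case: ltnP; rewrite !(andbT, andbF).
have yD1 : y \in D1 by rewrite inE yD leqnn.
rewrite /nc_sum_pointed /nc_sum big_distrl /=.
under [RHS]eq_bigr do rewrite big_distrr /=.
rewrite pair_big /=.
rewrite (reindex_onto (fun q : {set {set 'I_N}} * {set {set 'I_N}} => q.1 :|: q.2)
  (fun P => ([set V in P | V \subset D1], [set V in P | V \subset D2]))) /=; last first.
  move=> P /and3P[pP _ /split_atP sp]; apply/setP => V; rewrite !inE -andb_orr.
  apply: andb_idr => VP; have VD := partitionS pP VP.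
  by case: (sp V VP) => h; apply/orP; [left|right]; apply/subsetP => i iV;
    rewrite inE (subsetP VD) //= h.
have sub0 (V : {set 'I_N}) : V \subset D1 -> V \subset D2 -> V = set0.
  by move=> V1 V2; apply/eqP; rewrite -subset0 -(eqP (_ : D1 :&: D2 == set0)) ?subsetI ?V1 // setI_eq0.
have restr P1 P2 : partition P1 D1 -> partition P2 D2 ->
   [set V in P1 :|: P2 | V \subset D1] = P1 /\ [set V in P1 :|: P2 | V \subset D2] = P2.
  move=> p1 p2; split; apply/setP => V; rewrite !inE.
    apply/andP/idP => [[/orP[//|V2] V1]|V1]; last by rewrite V1 (partitionS p1).
    by case/negP: (partition_neq0 p2 V2); rewrite (sub0 V) // (partitionS p2).
  apply/andP/idP => [[/orP[V1|//] V2]|V2]; last by rewrite V2 orbT (partitionS p2).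
  by case/negP: (partition_neq0 p1 V1); rewrite (sub0 V) // (partitionS p1).
have union P1 P2 : partition P1 D1 -> partition P2 D2 -> partition (P1 :|: P2) D.
  move=> p1 p2; rewrite /partition /cover bigcup_setU.
  have := cover_partition p1; have := cover_partition p2; rewrite /cover => -> ->.
  rewrite DE eqxx inE !negb_or (partition0 p1) (partition0 p2) andbT /=.
  apply/trivIsetP => V W; rewrite !inE => VP WP neq.
  case/orP: VP => VP; case/orP: WP => WP.
  - exact: (trivIsetP (partition_trivIset p1)).
  - by rewrite (disjointW (partitionS p1 VP) (partitionS p2 WP)).
  - by rewrite disjoint_sym (disjointW (partitionS p1 WP) (partitionS p2 VP)).
  - exact: (trivIsetP (partition_trivIset p2)).
apply: eq_big => [[P1 P2]|[P1 P2]] /=.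
  apply/idP/idP.
    case/andP => /and3P[pP nc sp] /eqP[e1 e2].
    have nc1 (Q : {set {set 'I_N}}) : Q \subset P1 :|: P2 -> noncrossing Q.
      move=> /subsetP sQ; apply/noncrossingP => V W i j l m VQ WQ.
      by apply: (noncrossingP _ nc); apply: sQ.
    rewrite !nc1 ?subsetUl ?subsetUr // !andbT -e1 -{2}e2.
    have D1D : D1 \subset D by rewrite -DE subsetUl.
    have D2D : D2 \subset D by rewrite -DE subsetUr.
    have sV V : V \in P1 :|: P2 -> V \subset D1 \/ V \subset D2.
      move=> VP; have VD := partitionS pP VP.
      by case: (split_atP _ _ sp V VP) => h; [left|right]; apply/subsetP => i iV;
        rewrite inE (subsetP VD) //= h.
    rewrite !(partition_restrict pP) // => V /sV[]; try by left.
      by move=> V1; right; apply: disjointWl V1 _.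
    by move=> V2; right; rewrite disjoint_sym; apply: disjointWr V2 _.
  case/andP => /andP[p1 nc1] /andP[p2 nc2]; have [e1 e2] := restr _ _ p1 p2.
  rewrite e1 e2 eqxx andbT union //=; apply/andP; split.
    apply/noncrossingP => V W i j l m VP WP iV jW lV mW /andP[ij jl] lm.
    have in1 X z : X \in P1 -> z \in X -> (z <= y)%N.
      by move=> /(partitionS p1)/subsetP h /h; rewrite inE => /andP[].
    have in2 X z : X \in P2 -> z \in X -> (y < z)%N.
      by move=> /(partitionS p2)/subsetP h /h; rewrite inE => /andP[].
    move: VP WP; rewrite !inE => /orP[] VP /orP[] WP.
    - by apply: (noncrossingP _ nc1 V W i j l m) => //; apply/andP.
    - have := in1 _ _ VP lV; have := in2 _ _ WP jW; order_lia.
    - have := in1 _ _ WP jW; have := in2 _ _ VP iV; order_lia.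
    - by apply: (noncrossingP _ nc2 V W i j l m) => //; apply/andP.
  apply/split_atP => V; rewrite inE => /orP[] VP; [left|right] => i iV.
    by have := subsetP (partitionS p1 VP) i iV; rewrite inE => /andP[].
  by have := subsetP (partitionS p2 VP) i iV; rewrite inE => /andP[].
case/andP => /and3P[pP nc sp] /eqP[e1 e2].
have D1D : D1 \subset D by rewrite -DE subsetUl.
have D2D : D2 \subset D by rewrite -DE subsetUr.
have sV V : V \in P1 :|: P2 -> V \subset D1 \/ V \subset D2.
  move=> VP; have VD := partitionS pP VP.
  by case: (split_atP _ _ sp V VP) => h; [left|right]; apply/subsetP => i iV;
    rewrite inE (subsetP VD) //= h.
have p1 : partition P1 D1.
  rewrite -e1; apply: (partition_restrict pP) => // V /sV[]; first by left.
  by move=> V2; right; rewrite disjoint_sym; apply: disjointWr V2 _.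
have p2 : partition P2 D2.
  rewrite -e2; apply: (partition_restrict pP) => // V /sV[]; last by left.
  by move=> V1; right; apply: disjointWl V1 _.
have yc : y \in cover P1 by rewrite (cover_partition p1).
have VP := pblock_mem yc; have yV : y \in pblock P1 y by rewrite mem_pblock.
have bE : pblock (P1 :|: P2) y = pblock P1 y.
  by apply: def_pblock => //; [exact: partition_trivIset pP|rewrite inE VP].
rewrite bE -mulrA; congr (_ * _).
have VP2 : pblock P1 y \notin P2.
  apply/negP => VP2; have := subsetP (partitionS p2 VP2) y yV.
  by rewrite inE ltnn andbF.
rewrite (_ : (P1 :|: P2) :\ pblock P1 y = (P1 :\ pblock P1 y) :|: P2); last first.
  apply/setP => V; rewrite !inE; case: eqP => //= ->; exact/esym/negbTE.
rewrite (big_setID P2) /= mulrC; congr (_ * _).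
  suff -> : (P1 :\ pblock P1 y :|: P2) :\: P2 = P1 :\ pblock P1 y by [].
  apply/setP => V; rewrite !inE; case: (boolP (V \in P2)) => [V2|_]; rewrite ?orbF //=.
  apply/esym/negbTE/negP => /andP[_ V1].
  by case/negP: (partition_neq0 p2 V2); rewrite (sub0 V) // ?(partitionS p2) // (partitionS p1).
suff -> : (P1 :\ pblock P1 y :|: P2) :&: P2 = P2 by [].
by apply/setIidPr/subsetUr.
Qed.

(** A point x larger than all others can join the block B without a crossing
    exactly when B sees x from its last point y, that is, when no block straddles
    y.  The point y at which the partition splits is then unique. *)
Lemma noncrossing_add_max x B P D : partition P D -> B \in P ->
  (forall i, i \in D -> i < x)%N ->
  noncrossing ((x |: B) |: (P :\ B)) =
  noncrossing P && [exists y in B, split_at y P].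
Proof.
move=> pP BP Dx; have inD V i : V \in P -> i \in V -> i \in D.
  by move=> /(partitionS pP)/subsetP; apply.
have disP V W i : V \in P -> W \in P -> i \in V -> i \in W -> V = W.
  move=> VP WP iV iW; rewrite -(def_pblock (partition_trivIset pP) VP iV).
  exact: def_pblock (partition_trivIset pP) WP iW.
have xP V : V \in P -> x \in V = false.
  by move=> VP; apply/negP => /(inD _ _ VP)/Dx; rewrite ltnn.
apply/idP/andP => [nc|[nc /exists_inP[y yB sp]]].
  (* A crossing of two blocks of P remains one when x is added to B. *)
  have ncP : noncrossing P.
    apply/noncrossingP => V W i j k l VP WP iV jW kV lW ij kl.
    pose up V := if V == B then x |: V else V.
    have upP Z : Z \in P -> up Z \in (x |: B) |: (P :\ B).
      by move=> ZP; rewrite /up; case: (eqVneq Z B) => [->|neq]; rewrite !inE ?eqxx // neq ZP orbT.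
    have upS (Z : {set 'I_N}) (z : 'I_N) : z \in Z -> z \in up Z.
      by rewrite /up; case: eqP => // _ zZ; rewrite inE zZ orbT.
    have e : up V = up W.
      by apply: (noncrossingP _ nc _ _ i j k l) => //; (exact: upP || exact: upS).
    have : (i : 'I_N) \in up W by rewrite -e upS.
    rewrite /up; case: (eqVneq W B) => [_|_ iW]; last exact: disP iV iW.
    rewrite in_setU1 => /orP[/eqP ix|iB]; first by move: (xP _ VP); rewrite -ix iV.
    exact: disP iV iB.
  split=> //; have /set0Pn[b bB] := partition_neq0 pP BP.
  pose y := [arg max_(i > b in B) (i : nat)].
  have [yB ymax] : y \in B /\ {in B, forall i : 'I_N, (i <= y)%N}.
    by rewrite /y; case: arg_maxnP => // z zB zm; split=> // i iB; apply: zm.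
  apply/exists_inP; exists y => //; apply/split_atP => V VP.
  have [->|neq] := eqVneq V B; first by left.
  have yV (i : 'I_N) : i \in V -> i != y.
    by apply: contraTneq => ->; apply/negP => yV; case/eqP: neq; apply: disP yV yB.
  have [a aV|] := pickP (fun a : 'I_N => (a \in V) && (a < y)%N); last first.
    move=> h; right => i iV; have := h i; rewrite iV /= => /negbT; rewrite -leqNgt leq_eqVlt.
    by case/orP => // /eqP/val_inj e; have := yV _ iV; rewrite e eqxx.
  case/andP: aV => aV ay; left => c cV; rewrite leqNgt; apply/negP => yc.
  (* Otherwise a < y < c < x would be a crossing of V and x |: B. *)
  have e : V = x |: B.
    apply: (noncrossingP _ nc _ _ a y c x); rewrite ?inE ?eqxx ?neq ?VP ?yB ?orbT ?ay ?yc //.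
    exact/Dx/(inD _ _ VP).
  by have := xP _ VP; rewrite e setU11.
have ymax : {in B, forall i : 'I_N, (i <= y)%N}.
  by case: (split_atP _ _ sp B BP) => // h; have := h y yB; rewrite ltnn.
apply/noncrossingP => V W i j k l; rewrite !inE.
move=> /orP[/eqP->|/andP[VB VP]] /orP[/eqP->|/andP[WB WP]] iV jW kV lW ijk kl //.
- have lx := Dx _ (inD _ _ WP lW); case/andP: ijk => ij jk.
  have inB (z : 'I_N) : (z < x)%N -> z \in x |: B -> z \in B.
    by rewrite in_setU1 => zx /orP[/eqP e|//]; move: zx; rewrite e ltnn.
  have e : B = W.
    apply: (noncrossingP _ nc B W i j k l) => //; try (apply: inB => //; order_lia).
    by apply/andP.
  by rewrite e eqxx in WB.
- have kx := Dx _ (inD _ _ VP kV); case/andP: ijk => ij jk.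
  have jB : j \in B.
    by move: jW; rewrite in_setU1 => /orP[/eqP e|//]; move: jk; rewrite e; order_lia.
  have notB : {in V & B, forall a b : 'I_N, a != b}.
    by move=> a b aV bB; apply: contraNneq VB => e; apply/eqP/(disP _ _ a) => //; rewrite e.
  have e : V = B.
    move: lW; rewrite in_setU1 => /orP[/eqP lx|lB].
      have iy := ymax _ jB.
      case: (split_atP _ _ sp V VP) => h; last by have := h _ iV; order_lia.
      have ky := h _ kV; apply: (noncrossingP _ nc V B i j k y) => //; first exact/andP.
      by rewrite ltn_neqAle ky andbT; apply: notB.
    by apply: (noncrossingP _ nc V B i j k l) => //; apply/andP.
  by rewrite e eqxx in VB.
- exact: (noncrossingP _ nc V W i j k l).
Qed.

Lemma noncrossing_add_singleton x P D : partition P D ->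
  (forall i, i \in D -> i < x)%N ->
  noncrossing ([set x] |: P) = noncrossing P.
Proof.
move=> pP Dx; apply/idP/idP => nc; apply/noncrossingP => V W i j k l.
  by move=> VP WP; apply: (noncrossingP _ nc); rewrite inE ?VP ?WP orbT.
have lt V' (z : 'I_N) : V' \in P -> z \in V' -> (z < x)%N.
  by move=> /(partitionS pP)/subsetP h /h/Dx.
rewrite !inE => /orP[/eqP->|VP] /orP[/eqP->|WP] //.
- by rewrite inE => /eqP-> jW; rewrite inE => /eqP-> lW; order_lia.
- by move=> iV; rewrite inE => /eqP-> kV; rewrite inE => /eqP->; order_lia.
- by apply: (noncrossingP _ nc).
Qed.

(** Removing the largest point x: either x is alone in its block, or its block has
    a last point y before x, and the partition of the remaining points splits after
    y. *)
Lemma nc_sum_pointed_max k x D : x \in D -> (forall i, i \in D :\ x -> i < x)%N ->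
  nc_sum_pointed k x D = u k.+1 * nc_sum (D :\ x) +
   \sum_(y in D :\ x) nc_sum_pointed k.+1 y [set i in D :\ x | (i <= y)%N] *
     nc_sum [set i in D :\ x | (y < i)%N].
Proof.
move=> xD Dx; set D' := D :\ x in Dx *.
pose F V Q := if (x \in V) && noncrossing (V |: Q) then
   u (#|V| + k)%N * \prod_(W in Q) u #|W| else 0.
pose G B Q := if noncrossing ((x |: B) |: Q) then
   u (#|B| + k.+1)%N * \prod_(W in Q) u #|W| else 0.
transitivity (\sum_(P : {set {set 'I_N}} | partition P D) \sum_(V in P) F V (P :\ V)).
  rewrite /nc_sum_pointed big_mkcondr /=; apply: eq_bigr => P pP.
  have xc : x \in cover P by rewrite (cover_partition pP).
  have VP := pblock_mem xc; rewrite [RHS](bigD1 (pblock P x)) //=.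
  rewrite {1}/F setD1K // mem_pblock xc /= [X in _ + X]big1 ?addr0 // => V /andP[WP neq].
  rewrite /F; case: ifP => // /andP[xV _].
  by rewrite (def_pblock (partition_trivIset pP) WP xV) eqxx in neq.
rewrite sum_marked_block.
transitivity (\sum_(B : {set 'I_N} | B \subset D')
   \sum_(Q : {set {set 'I_N}} | partition Q (D' :\: B)) G B Q).
  transitivity (\sum_(V : {set 'I_N} | (x \in V) && (V \subset D))
     \sum_(Q : {set {set 'I_N}} | partition Q (D :\: V)) F V Q).
    rewrite big_mkcond [RHS]big_mkcond; apply: eq_bigr => V _ /=.
    case: (boolP (x \in V)) => xV /=.
      by have -> : V != set0 by apply/set0Pn; exists x.
    by case: ifP => // _; rewrite big1 // => Q _; rewrite /F (negPf xV).
  rewrite (reindex_onto (fun W => x |: W) (fun V => V :\ x)) /=; last first.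
    by move=> V /andP[xV _]; rewrite setD1K.
  apply: eq_big => W.
    rewrite setU11 /= subUset sub1set xD /= /D' subsetD1.
    apply/idP/idP => [/andP[-> /eqP <-]|/andP[-> xW]]; first by rewrite !inE eqxx.
    by rewrite setU1K // eqxx.
  case/andP => _ /eqP WE; have xW : x \notin W by rewrite -WE !inE eqxx.
  rewrite -setDDl; apply: eq_bigr => Q _.
  by rewrite /F /G setU11 cardsU1 xW add1n addSnnS.
rewrite (bigD1 set0) ?sub0set //=; congr (_ + _).
  rewrite setD0 /nc_sum big_distrr [RHS]big_mkcondr /=; apply: eq_bigr => Q pQ.
  by rewrite /G setU0 (noncrossing_add_singleton pQ Dx) cards0.
rewrite (eq_bigl (fun B => (B != set0) && (B \subset D'))) => [|B]; last by rewrite andbC.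
rewrite -sum_marked_block.
under [RHS]eq_bigr => y yD' do rewrite -nc_sum_split //.
rewrite (exchange_big_dep (fun P => partition P D')) /=; last by move=> ? ? _ /and3P[].
apply: eq_bigr => P pP.
pose g B := u (#|B| + k.+1)%N * \prod_(W in P :\ B) u #|W|.
transitivity (\sum_(y in D') (if noncrossing P && split_at y P then g (pblock P y) else 0)); last first.
  by rewrite [RHS]big_mkcondr /=; apply: eq_bigr => y _; rewrite pP.
rewrite (set_partition_big _ pP) /=; apply: eq_bigr => B BP.
rewrite /G (noncrossing_add_max pP BP Dx) -/(g B).
rewrite (eq_bigr (fun y => if noncrossing P && split_at y P then g B else 0)); last first.
  by move=> y yB; rewrite (def_pblock (partition_trivIset pP) BP yB).
case: noncrossing; last by rewrite big1.
rewrite /=; case: exists_inP => [[y yB sp]|h]; last first.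
  rewrite big1 // => y yB; case: ifP => // sp.
  by case: h; exists y.
rewrite (bigD1 y) //= sp big1 ?addr0 // => z /andP[zB zy]; case: ifP => // spz.
have le1 : (z <= y)%N.
  by case: (split_atP _ _ sp B BP) => h; [apply: h|have := h y yB; rewrite ltnn].
have le2 : (y <= z)%N.
  by case: (split_atP _ _ spz B BP) => h; [apply: h|have := h z zB; rewrite ltnn].
by case/eqP: zy; apply/val_inj/eqP; rewrite eqn_leq le1.
Qed.

Lemma set_max D : D != set0 -> exists2 x, x \in D & forall i, i \in D :\ x -> (i < x)%N.
Proof.
case/set0Pn => b bD; pose x := [arg max_(i > b in D) (i : nat)].
have [xD xm] : x \in D /\ {in D, forall i : 'I_N, (i <= x)%N}.
  by rewrite /x; case: arg_maxnP => // z zD zm; split=> // i iD; apply: zm.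
exists x => // i; rewrite !inE => /andP[ix iD].
by rewrite ltn_neqAle xm // andbT.
Qed.

Lemma sum_ranks (S : nmodType) (F : nat -> S) D :
  \sum_(y in D) F #|[set i in D | (i < y)%N]| = \sum_(j < #|D|) F j.
Proof.
have [n] := ubnP #|D|; elim: n D => // n IH D; rewrite ltnS => Dn.
have [->|/set_max[x xD xm]] := eqVneq D set0; first by rewrite big_set0 cards0 big_ord0.
have cD : #|D| = #|D :\ x|.+1 by rewrite (cardsD1 x D) xD.
rewrite (big_setD1 x) //= cD big_ord_recr /= addrC -IH -?cD //; congr (_ + _).
  apply: eq_bigr => y yD; suff -> : [set i in D | (i < y)%N] = [set i in D :\ x | (i < y)%N] by [].
  apply/setP => i; rewrite !inE; case: eqP => //= ->.
  by have := xm y yD; case: ltnP; rewrite ?andbF // => h1 h2; order_lia.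
congr (F #|pred_of_set _|); apply/setP => i; rewrite !inE.
case: eqP => [->|/eqP ix]; first by rewrite ltnn andbF.
by apply: andb_idr => iD; apply: xm; rewrite !inE ix.
Qed.

(** The recursion of [nc_sum_pointed_max] in terms of cardinals, A k n standing for
    the pointed sum over n + 1 points. *)
Lemma nc_sumE (a : nat -> R) (A : nat -> nat -> R) :
  a 0%N = 1 -> (forall n, a n.+1 = A 0%N n) ->
  (forall k n, A k n = u k.+1 * a n + \sum_(j < n) A k.+1 j * a (n - j.+1)%N) ->
  forall D, nc_sum D = a #|D|.
Proof.
move=> a0 aS AE D; have [n] := ubnP #|D|; elim: n D => // n IH D; rewrite ltnS => Dn.
have [->|D0] := eqVneq D set0; first by rewrite nc_sum_set0 cards0.
(* An inner induction, as the pointed sums recur among themselves. *)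
have ptd m (E : {set 'I_N}) k x : (#|E| <= m)%N -> (#|E| <= n)%N -> x \in E ->
    (forall i, i \in E :\ x -> (i < x)%N) -> nc_sum_pointed k x E = A k #|E|.-1.
  elim: m E k x => [|m IHm] E k x Em En xE xm.
    by move: xE; rewrite (cards0_eq (_ : #|E| = 0%N)) ?inE //; order_lia.
  have cE : #|E| = #|E :\ x|.+1 by rewrite (cardsD1 x E) xE.
  rewrite (nc_sum_pointed_max _ xE xm) AE IH ?cE /=; last by rewrite -cE.
  congr (_ + _); set E' := E :\ x in cE xm *.
  rewrite -(sum_ranks (fun j => A k.+1 j * a (#|E'| - j.+1)%N)); apply: eq_bigr => y yE.
  have c1 : #|[set i in E' | (i <= y)%N]| = #|[set i in E' | (i < y)%N]|.+1.
    rewrite (cardsD1 y) inE yE leqnn add1n; congr (#|pred_of_set _|.+1).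
    apply/setP => i; rewrite !inE (ltn_neqAle i y) -val_eqE /=.
    by case: (i == y :> nat); rewrite ?andbF.
  have c2 : (#|[set i in E' | (i <= y)%N]| + #|[set i in E' | (y < i)%N]| = #|E'|)%N.
    rewrite -cardsUI [X in (_ + X)%N](_ : _ = 0%N) ?addn0; last first.
      apply/eqP; rewrite cards_eq0; apply/eqP/setP => i; rewrite !inE ltnNge.
      by case: leqP; rewrite ?andbF.
    congr #|pred_of_set _|; apply/setP => i; rewrite !inE ltnNge.
    by case: leqP; rewrite ?andbF ?andbT ?orbF.
  rewrite IHm ?c1 /=; first 1 last.
  - by rewrite -c1; order_lia.
  - by rewrite -c1; order_lia.
  - by rewrite inE yE leqnn.
  - by move=> i; rewrite !inE -!andbA => /and4P[iy _ _ le]; rewrite ltn_neqAle le andbT.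
  rewrite IH; last by rewrite (leq_trans _ En) // cE ltnS -c2 leq_addl.
  by rewrite -c1 -c2 addKn.
have [x xD xm] := set_max D0.
rewrite (nc_sum_pointed0 xD) (ptd #|D|) // -aS prednK //.
by apply/card_gt0P; exists x.
Qed.

End NonCrossing.

(* Imported only here, so that set notations denote finite sets above. *)
From mathcomp Require Import all_classical all_reals all_analysis.
From mathcomp Require Import complex polyrcf.
Import numFieldNormedType.Exports.

(** * The ring of formal power series *)

(** An alias that gives sequences the Cauchy product; functions with values in a
    ring carry the pointwise product. *)
Definition fps (R : realType) : Type := nat -> R.

Section SeriesRing.
Variable R : realType.
Implicit Types f g h : nat -> R.

Lemma coef_trunc f N n : (n < N)%N -> (\poly_(i < N) f i)`_n = f n.
Proof. by move=> nN; rewrite coef_poly nN. Qed.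

Lemma fps_mulE f g N n : (n < N)%N ->
  fps_mul f g n = ((\poly_(i < N) f i) * (\poly_(i < N) g i))`_n.
Proof.
move=> nN; rewrite coefM; apply: eq_bigr => -[i /= ilt] _.
by rewrite !coef_trunc //; lia.
Qed.

Definition fps_one : nat -> R := fun n => (n == 0%N)%:R.

Lemma fps_mulC : commutative (@fps_mul R).
Proof. by move=> f g; apply/funext => n; rewrite !(@fps_mulE _ _ n.+1) // mulrC. Qed.

Lemma fps_mulA : associative (@fps_mul R).
Proof.
move=> f g h; apply/funext => n; rewrite !(@fps_mulE _ _ n.+1) //.
rewrite [LHS]coefM [RHS]coefM.
transitivity (((\poly_(i < n.+1) f i) * ((\poly_(i < n.+1) g i) * (\poly_(i < n.+1) h i)))`_n).
  rewrite [RHS]coefM; apply: eq_bigr => -[i /= ilt] _; congr (_ * _).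
  by rewrite coef_trunc ?(@fps_mulE _ _ n.+1) //; lia.
rewrite mulrA [LHS]coefM; apply: eq_bigr => -[i /= ilt] _; congr (_ * _).
by rewrite coef_trunc ?(@fps_mulE _ _ n.+1) //; lia.
Qed.

Lemma fps_mul1 : left_id fps_one (@fps_mul R).
Proof.
move=> f; apply/funext => n; rewrite /fps_mul big_ord_recl /= mul1r subn0.
by rewrite big1 ?addr0 // => i _; rewrite mul0r.
Qed.

Lemma fps_mulDl : left_distributive (@fps_mul R) (fun f g => f + g).
Proof.
move=> f g h; apply/funext => n; rewrite -[RHS]/(fps_mul f h n + fps_mul g h n).
by rewrite /fps_mul -big_split /=; apply: eq_bigr => i _; rewrite mulrDl.
Qed.

Lemma fps_one_neq0 : fps_one != 0.
Proof.
by apply/eqP => /(congr1 (fun f : nat -> R => f 0%N))/eqP; rewrite oner_eq0.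
Qed.

HB.instance Definition _ := GRing.Zmodule.copy (fps R) (nat -> R).
HB.instance Definition _ := GRing.Zmodule_isComNzRing.Build (fps R)
  fps_mulA fps_mulC fps_mul1 fps_mulDl fps_one_neq0.

End SeriesRing.

Section Series.
Variable R : realType.
Implicit Types f g h : fps R.

Lemma fpsM f g n : (f * g) n = \sum_(i < n.+1) f i * g (n - i)%N.
Proof. by []. Qed.
Lemma fpsD f g n : (f + g) n = f n + g n.
Proof. by []. Qed.
Lemma fpsN f n : (- f) n = - f n.
Proof. by []. Qed.
Lemma fps0 n : (0 : fps R) n = 0.
Proof. by []. Qed.
Lemma fps1 n : (1 : fps R) n = (n == 0%N)%:R.
Proof. by []. Qed.

Lemma fps_sum (I : Type) (r : seq I) (P : pred I) (F : I -> fps R) n :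
  (\sum_(i <- r | P i) F i) n = \sum_(i <- r | P i) F i n.
Proof.
by elim/big_rec2: _ => [|i x y _ <-]; rewrite ?fps0 // fpsD.
Qed.

Lemma fps_powE f k : fps_pow f k = f ^+ k.
Proof. by elim: k => [|k IH]; rewrite ?expr0 // exprS -IH. Qed.

Definition fpsC (a : R) : fps R := fun n => if n is 0%N then a else 0.

Lemma fpsCM a f n : (fpsC a * f) n = a * f n.
Proof.
rewrite fpsM big_ord_recl /= subn0 big1 ?addr0 // => i _.
by rewrite mul0r.
Qed.

Definition fpsX : fps R := fun n => (n == 1%N)%:R.

Lemma fpsX0 f : (fpsX * f) 0%N = 0.
Proof. by rewrite fpsM big_ord1 mul0r. Qed.

Lemma fpsXS f n : (fpsX * f) n.+1 = f n.
Proof.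
rewrite fpsM big_ord_recl /= mul0r add0r big_ord_recl /= mul1r subSS subn0.
by rewrite big1 ?addr0 // => i _; rewrite mul0r.
Qed.

Definition euler f : fps R := fun n => n%:R * f n.

Lemma eulerM f g : euler (f * g) = euler f * g + f * euler g.
Proof.
apply/funext => n; rewrite fpsD !fpsM /euler fpsM big_distrr -big_split /=.
apply: eq_bigr => -[i /= ilt] _; rewrite -{1}(@subnKC i n) //; ring.
Qed.

Definition dz f : fps R := fps_deriv_inv f.

(** For w = 1/z one has d/dz = - w (w d/dw). *)
Lemma dzE f : dz f = - (fpsX * euler f).
Proof.
apply/funext => -[|n]; rewrite fpsN ?fpsX0 ?oppr0 // fpsXS //.
Qed.

Lemma dzM f g : dz (f * g) = dz f * g + f * dz g.
Proof. by rewrite !dzE eulerM; ring. Qed.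

Lemma euler1 : euler 1 = 0.
Proof. by apply/funext => -[|n]; rewrite /euler fps1 ?mul0r ?mulr0. Qed.

Lemma eulerD f g : euler (f + g) = euler f + euler g.
Proof. by apply/funext => n; rewrite /euler !fpsD /euler mulrDr. Qed.

Lemma eulerC a : euler (fpsC a) = 0.
Proof. by apply/funext => -[|n]; rewrite /euler /= ?mul0r ?mulr0. Qed.

Lemma eulerX : euler fpsX = fpsX.
Proof.
by apply/funext => -[|[|n]]; rewrite /euler /fpsX /= ?mul0r ?mulr0 ?mul1r.
Qed.

(** Congruence modulo w^(N+1).  Infinite sums of series are treated modulo such
    powers, where they are finite. *)
Definition eq_upto N f g := forall n, (n <= N)%N -> f n = g n.

Lemma eq_uptoM N f f' g g' : eq_upto N f f' -> eq_upto N g g' ->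
  eq_upto N (f * g) (f' * g').
Proof.
move=> ef eg n nN; rewrite !fpsM; apply: eq_bigr => -[i /= ilt] _.
by rewrite ef ?eg //; lia.
Qed.

Lemma regular_upto N f h : f 0%N = 1 -> eq_upto N (f * h) 0 -> eq_upto N h 0.
Proof.
move=> f0 fh n; have [m] := ubnP n; elim: m n => // m IH n; rewrite ltnS => nm nN.
have := fh n nN; rewrite fpsM big_ord_recl /= f0 mul1r subn0 big1 ?addr0 //.
case=> i /= ilt _; rewrite IH ?mulr0 //; rewrite /bump; lia.
Qed.

Lemma order_exp f k n : f 0%N = 0 -> (n < k)%N -> (f ^+ k) n = 0.
Proof.
move=> f0; elim: k n => // k IH n nk; rewrite exprS fpsM big_ord_recl /= f0 mul0r add0r.
by rewrite big1 // => -[i /= ilt] _; rewrite IH ?mulr0 // /bump; lia.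
Qed.

End Series.

(** * The loop equation *)

(** For weights a b^(k-1), inserting one more point either opens a new cycle, with
    factor a, or goes after one of the n points, with factor b. *)
Lemma sym_sum_geometric (R : comNzRingType) (a b : R) n :
  sym_sum (fun k => a * b ^+ k.-1) n = \prod_(i < n) (a + b *+ i).
Proof.
set u := fun k => _.
suff step m : sym_sum u m.+1 = (a + b *+ m) * sym_sum u m.
  elim: n => [|n IH]; first by rewrite big_ord0 sym_sum0.
  by rewrite step big_ord_recr IH mulrC.
case: m => [|m].
  by rewrite sym_sumS big_ord1 subnn sym_sum0 /u /= expr0 !mulr1 mulr0n addr0.
rewrite sym_sumS big_ord_recl /= subn0 bin0 mulrDl; congr (_ + _).
  by rewrite /u /= expr0 !mulr1.
rewrite [sym_sum u m.+1 in RHS]sym_sumS big_distrr; apply: eq_bigr => -[k /= km] _.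
rewrite /bump /= add1n subSS /u /= -[LHS]mulr_natr -[b *+ _]mulr_natr.
rewrite -[X in _ = _ * X]mulr_natr exprS factS natrM.
have : (m.+1)%:R * ('C(m, k))%:R = (k.+1)%:R * ('C(m.+1, k.+1))%:R :> R.
  by rewrite -!natrM mul_bin_diag.
set x := m.+1%:R; set y := (k.+1)%:R => e.
transitivity (a * (b * b ^+ k) * k`!%:R * sym_sum u (m - k) * (y * 'C(m.+1, k.+1)%:R)).
  by ring.
by rewrite -e; ring.
Qed.

Section Loop.
Variables (R : realType) (kappa : nat -> R) (D : R).
Hypothesis D0 : D != 0.

(** With these weights the sums over permutations of [n] are the normalised
    coefficients e_n; see [poly_moment_ff]. *)
Definition cumulant_weight (k : nat) : R := kappa k * (- D^-1) ^+ k.-1.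
(** With these weights the sums over permutations of [n] are the falling factorials
    of D; see [sv_prod]. *)
Definition falling_weight (k : nat) : R := D * (-1) ^+ k.-1.

Local Notation su := (sym_sum cumulant_weight).
Local Notation sv := (sym_sum falling_weight).

(** The n-th moment in degree D as a function of the cumulants, defined for
    arbitrary cumulants so that kappa can be held fixed while D varies. *)
Definition ff_moment (n : nat) : R :=
  if n is n'.+1 then (-1) ^+ n' / (n'`!%:R * D) *
     conn_sum cumulant_weight falling_weight ord0 [set: 'I_n'.+1]%SET
  else 1.

(** Newton's identities in exponential normalisation: they have the shape of the
    exponential formula, so the power sums are the connected weights. *)
Definition newton_rec (z m : nat -> R) n :=
   \sum_(k < n.+1) ((-1) ^+ k * k`!%:R * D * m k.+1) * z (n - k)%N *+ 'C(n, k).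

Lemma factR_neq0 n : (n`!)%:R != 0 :> R.
Proof. by rewrite pnatr_eq0 -lt0n fact_gt0. Qed.

Lemma ff_moment_rec n : su n.+1 * sv n.+1 = newton_rec (fun n => su n * sv n) ff_moment n.
Proof.
have [|c crec] := @component_weight_exists R (fun n => su n * sv n).
  by rewrite !sym_sum0 mulr1.
rewrite crec; apply: eq_bigr => k _; congr (_ * _ *+ _).
rewrite /ff_moment (conn_sumE crec) ?finset.inE // cardsT card_ord.
have := factR_neq0 k; move: (k`!)%:R => f f0.
have sq : (-1) ^+ k * (-1) ^+ k = 1 :> R by rewrite -signr_odd; case: odd; ring.
transitivity (((-1) ^+ k * (-1) ^+ k) * c k.+1); first by rewrite sq mul1r.
by field; rewrite f0 D0.
Qed.

Lemma ff_moment_unique (m : nat -> R) :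
  (forall n, su n.+1 * sv n.+1 = newton_rec (fun n => su n * sv n) m n) ->
  forall n, ff_moment n.+1 = m n.+1.
Proof.
move=> mrec n; pose c k := (-1) ^+ k.-1 * (k.-1)`!%:R * D * m k.
rewrite /ff_moment (@conn_sumE _ _ _ c) ?finset.inE //.
rewrite cardsT card_ord /c /=.
have := factR_neq0 n; move: (n`!)%:R => f f0.
have sq : (-1) ^+ n * (-1) ^+ n = 1 :> R by rewrite -signr_odd; case: odd; ring.
transitivity (((-1) ^+ n * (-1) ^+ n) * m n.+1); last by rewrite sq mul1r.
by field; rewrite f0 D0.
Qed.

(** The coefficients of a polynomial from the leading one down, that is, w^D p as
    a series in w = 1/z. *)
Definition rev_series (z : nat -> R) : fps R := fun n => (-1) ^+ n * z n / n`!%:R.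

Lemma newton_recE (z m : nat -> R) n :
  m 0%N = 1 ->
  - (D * (rev_series z * ((m : fps R) - 1)) n.+1) =
  (-1) ^+ n.+1 / n`!%:R * newton_rec z m n.
Proof.
move=> m0; rewrite fpsM big_ord_recr /= subnn fpsD fpsN fps1 m0 subrr mulr0 addr0.
rewrite (reindex_inj rev_ord_inj) /= /newton_rec !big_distrr -sumrN /=.
apply: eq_bigr => -[k /= kn] _; rewrite subSS.
have -> : (n.+1 - (n - k) = k.+1)%N by lia.
rewrite fpsD fpsN fps1 subr0 /rev_series -[_ *+ 'C(_, _)]mulr_natr.
have := bin_fact (kn : (k <= n)%N) => /(congr1 (fun i : nat => i%:R : R)).
rewrite !natrM => <-.
have -> : (-1) ^+ n.+1 = - ((-1) ^+ (n - k) * (-1) ^+ k) :> R.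
  by rewrite -exprD subnK // exprS mulN1r.
have sq : (-1) ^+ k * (-1) ^+ k = 1 :> R by rewrite -signr_odd; case: odd; ring.
have := factR_neq0 k; have := factR_neq0 (n - k).
have : ('C(n, k))%:R != 0 :> R by rewrite pnatr_eq0 -lt0n bin_gt0.
move: (k`!)%:R ((n - k)`!)%:R ('C(n, k))%:R => f g b b0 f0 g0.
transitivity (- (D * ((-1) ^+ (n - k) * z (n - k)%N / g * (m k.+1))) * ((-1) ^+ k * (-1) ^+ k)).
  by rewrite sq mulr1.
by field; rewrite b0 f0 g0.
Qed.

Lemma euler_rev_series (z : nat -> R) n :
  euler (rev_series z) n.+1 = (-1) ^+ n.+1 / n`!%:R * z n.+1.
Proof.
rewrite /euler /rev_series factS natrM; have := factR_neq0 n.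
have : (n.+1)%:R != 0 :> R by rewrite pnatr_eq0.
by move: (n.+1)%:R (n`!)%:R => a b a0 b0; field; rewrite a0 b0.
Qed.

(** Newton's identities amount to z p' = D M p, where M is the generating series of
    the moments. *)
Lemma newton_euler (z m : nat -> R) : m 0%N = 1 ->
  (forall n, z n.+1 = newton_rec z m n) <->
  euler (rev_series z) = - (fpsC D * (rev_series z * ((m : fps R) - 1))).
Proof.
move=> m0; split=> [zm|e n].
  apply/funext => -[|n]; rewrite fpsN fpsCM.
    by rewrite /euler mul0r fpsM big_ord1 fpsD fpsN fps1 m0 subrr !mulr0 oppr0.
  by rewrite euler_rev_series zm -newton_recE // mulrN.
have := congr1 (fun f : fps R => f n.+1) e.
rewrite euler_rev_series fpsN fpsCM newton_recE //.
apply: mulfI; rewrite mulf_neq0 ?invr_eq0 ?factR_neq0 //.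
by rewrite expf_neq0 // oppr_eq0 oner_eq0.
Qed.

(** The operator p |-> p'/D on polynomials of degree D, written for w^D p. *)
Definition dilated_deriv (f : fps R) : fps R :=
  fpsC D^-1 * (fpsX R * (fpsC D * f - euler f)).

(** The series Q_k = p^(k) / (D^k p). *)
Fixpoint log_deriv_iter (G : fps R) (k : nat) : fps R :=
  if k is k'.+1 then
    G * log_deriv_iter G k' + fpsC D^-1 * dz (log_deriv_iter G k')
  else 1.

(** Induction by the product rule, starting from p'/(D p) = G. *)
Lemma dilated_derivE (P : fps R) (m : nat -> R) k :
  euler P = - (fpsC D * (P * ((m : fps R) - 1))) ->
  iter k dilated_deriv P = P * log_deriv_iter (cauchy_series m) k.
Proof.
move=> eP; elim: k => [|k IH]; first by rewrite /= mulr1.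
have GE : cauchy_series m = fpsX R * (m : fps R) :> fps R.
  by apply/funext => -[|n]; rewrite ?fpsX0 ?fpsXS.
have DC : fpsC D^-1 * fpsC D = 1 :> fps R.
  by apply/funext => -[|n]; rewrite fpsCM fps1 /= ?mulVf ?mulr0.
rewrite iterS IH /dilated_deriv /= eulerM eP dzE GE.
set Q := log_deriv_iter _ _; set c := fpsC D^-1; set d := fpsC D.
transitivity ((c * d) * (P * (fpsX R * (m : fps R) * Q)) - c * (P * (fpsX R * euler Q))).
  by ring.
by rewrite DC; ring.
Qed.

Lemma dilated_deriv_lt (P : fps R) k n : (n < k)%N -> iter k dilated_deriv P n = 0.
Proof.
elim: k n => // k IH [|n] nk; rewrite iterS /dilated_deriv fpsCM ?fpsX0 ?mulr0 //.
by rewrite fpsXS fpsD fpsN fpsCM /euler IH // !mulr0 subr0 mulr0.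
Qed.

Lemma dilated_deriv_coef (P : fps R) k n :
  iter k dilated_deriv P (n + k)%N = D^-1 ^+ k * \prod_(j < k) (D - (n + j)%:R) * P n.
Proof.
elim: k => [|k IH]; first by rewrite big_ord0 addn0 !mul1r.
rewrite iterS addnS /dilated_deriv fpsCM fpsXS fpsD fpsN fpsCM /euler IH.
by rewrite big_ord_recr exprS /=; ring.
Qed.

Definition rev_poly := rev_series (fun n => su n * sv n).

Lemma sv_prod n : sv n = \prod_(i < n) (D - i%:R).
Proof.
by rewrite sym_sum_geometric; apply: eq_bigr => i _; rewrite mulNrn.
Qed.

(** The recursion for the e_n over the cycle of a point, multiplied by binomial
    coefficients, reads z p' - D p = D sum_k kappa_k p^(k) / D^k. *)
Lemma rev_poly_cumulants n :
  - (D^-1 * euler rev_poly n.+1) =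
  \sum_(k < n.+1) kappa k.+1 * iter k.+1 dilated_deriv rev_poly n.+1.
Proof.
rewrite euler_rev_series sym_sumS !(big_distrl, big_distrr) -sumrN /=.
apply: eq_bigr => -[k /= kn] _; have {}kn : (k <= n)%N by [].
have := dilated_deriv_coef rev_poly k.+1 (n - k).
rewrite addnS subnK //= => ->; rewrite /rev_poly /rev_series.
have -> : sv n.+1 = sv (n - k)%N * \prod_(j < k.+1) (D - (n - k + j)%N%:R).
  rewrite !sv_prod -!(big_mkord xpredT (fun i => D - i%:R)).
  rewrite (@big_cat_nat _ _ _ (n - k)%N) ?leqW ?leq_subr //=; congr (_ * _).
  rewrite -{1}[(n - k)%N]add0n big_addn big_mkord.
  have -> : (n.+1 - (n - k) = k.+1)%N by lia.
  by apply: eq_bigr => j _; rewrite addnC.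
rewrite /cumulant_weight /= -[_ *+ 'C(_, _)]mulr_natr.
have := bin_fact kn => /(congr1 (fun i : nat => i%:R : R)).
rewrite !natrM => <-.
have -> : (-1) ^+ n.+1 = - ((-1) ^+ (n - k) * (-1) ^+ k) :> R.
  by rewrite -exprD subnK // exprS mulN1r.
have -> : (- D^-1) ^+ k = (-1) ^+ k * D^-1 ^+ k by rewrite -exprMn mulN1r.
have sq : (-1) ^+ k * (-1) ^+ k = 1 :> R by rewrite -signr_odd; case: odd; ring.
have := factR_neq0 k; have := factR_neq0 (n - k).
have : ('C(n, k))%:R != 0 :> R by rewrite pnatr_eq0 -lt0n bin_gt0.
move: (k`!)%:R ((n - k)`!)%:R ('C(n, k))%:R (\prod_(j < _) _) => f g b p b0 f0 g0.
rewrite exprS; move: (D^-1 ^+ k) => Dk.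
transitivity (kappa k.+1 * (D^-1 * Dk * p * ((-1) ^+ (n - k) * (su (n - k)%N * sv (n - k)%N) / g))
   * ((-1) ^+ k * (-1) ^+ k)); last by rewrite sq mulr1.
by field; rewrite b0 f0 g0 D0.
Qed.

(** Divide [rev_poly_cumulants] by D p.  Dividing is legitimate since the leading
    coefficient of p is 1. *)
Theorem loop_equation N :
  let G : fps R := cauchy_series ff_moment in
  eq_upto N G
    (fpsX R * (1 + \sum_(k < N) fpsC (kappa k.+1) * log_deriv_iter G k.+1)).
Proof.
move=> G; have eP : euler rev_poly = - (fpsC D * (rev_poly * ((ff_moment : fps R) - 1))).
  by apply/newton_euler => //; apply: ff_moment_rec.
have P0 : rev_poly 0%N = 1 by rewrite /rev_poly /rev_series !sym_sum0 /= !mul1r invr1.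
suff: eq_upto N (G - fpsX R * (1 + \sum_(k < N) fpsC (kappa k.+1) * log_deriv_iter G k.+1)) 0.
  by move=> h n nN; apply/eqP; rewrite -subr_eq0; apply/eqP/(h n nN).
apply: (@regular_upto _ _ rev_poly) => // n nN.
have PG : rev_poly * G = dilated_deriv rev_poly.
  have := dilated_derivE 1 eP => /= ->; rewrite mulr1 dzE euler1 mulr0 oppr0 mulr0 addr0.
  by [].
have PS : rev_poly * (\sum_(k < N) fpsC (kappa k.+1) * log_deriv_iter G k.+1) =
   \sum_(k < N) fpsC (kappa k.+1) * iter k.+1 dilated_deriv rev_poly.
  rewrite big_distrr; apply: eq_bigr => k _.
  by rewrite (dilated_derivE _ eP) /= mulrCA.
rewrite mulrBr PG mulrCA mulrDr mulr1 PS fpsD fpsN fps0.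
case: n nN => [|n] nN; first by rewrite /dilated_deriv fpsCM !fpsX0 mulr0 subr0.
rewrite {1}/dilated_deriv fpsCM !fpsXS !fpsD fpsN fpsCM mulrBr mulKf //.
rewrite opprD addrACA subrr add0r fps_sum.
case: n nN => [|n] nN.
  rewrite /euler mul0r mulr0 oppr0 sub0r big1 ?oppr0 // => k _.
  by rewrite fpsCM dilated_deriv_lt ?mulr0.
rewrite rev_poly_cumulants (big_ord_widen N
  (fun k => kappa k.+1 * iter k.+1 dilated_deriv rev_poly n.+1)) ?(ltnW nN) //.
rewrite big_mkcond -sumrB big1 // => k _; rewrite fpsCM; case: ifP => kn.
  by rewrite subrr.
have -> : iter k.+1 dilated_deriv rev_poly n.+1 = 0.
  by apply: dilated_deriv_lt; lia.
by rewrite mulr0 subrr.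
Qed.

End Loop.

(** * The genus expansion of the moments *)

Section GenusExpansion.
Variable R : realType.
Implicit Types (kappa : nat -> R).

(** The coefficient of (-1/D)^g in the n-th moment. *)
Definition genus_sum kappa (n g : nat) : R :=
  (n.-1)`!%:R^-1 * \sum_(s : 'S_n) \sum_(t : 'S_n | transitive_pair s t && (genus_defect s t == g))
    orbit_prod kappa s.

Lemma ff_moment_genus kappa (D : R) n : D != 0 -> (0 < n)%N ->
  ff_moment kappa D n = \sum_(g < n.+2) (- D^-1) ^+ g * genus_sum kappa n g.
Proof.
move=> D0; case: n => // n _; rewrite /ff_moment.
transitivity (n`!%:R^-1 * ((-1) ^+ n / D *
   conn_sum (cumulant_weight kappa D) (falling_weight D) ord0 [set: 'I_n.+1]%SET)).
  have := factR_neq0 R n; move: ((-1) ^+ n) => x f0; move: f0.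
  by move: (n`!%:R) => f f0; field; rewrite f0 D0.
rewrite conn_sum_genus //.
under [RHS]eq_bigr do rewrite /genus_sum mulrCA.
rewrite -big_distrr /=; congr (_ * _).
under [RHS]eq_bigr do rewrite big_distrr /=.
rewrite [RHS]exchange_big /=; apply: eq_bigr => s _.
have ltd (t : 'S_n.+1) : (genus_defect s t < n.+3)%N.
  by rewrite /genus_defect card_ord ltnS -subnDA leq_subr.
rewrite (partition_big (fun t => inord (genus_defect s t) : 'I_n.+3) predT) //=.
apply: eq_bigr => g _; rewrite big_distrr /=; apply: eq_big => [t|t /andP[_ /eqP <-]].
  by rewrite -val_eqE /= inordK.
by rewrite inordK.
Qed.

Lemma sum_marked_annular kappa t s n : (0 < t)%N -> (0 < s)%N -> (t + s)%N = n ->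
  \sum_(q : 'S_n * 'I_n * 'I_n | marked_two_cycles t s q) annular_sum kappa q.1.1 =
  annular_sum kappa (two_cycles t s) *+ n`! :> R.
Proof.
move=> t0 s0 <-.
exact: (sum_marked_two_cycles t0 s0 (fun r g => annular_sumJ kappa r g)).
Qed.

(** Transitive pairs of defect 1 have a product with two cycles; grouping them by
    this product and averaging over conjugates leaves the standard annular
    permutation. *)
Lemma genus_sum_annular kappa n : (0 < n)%N ->
  genus_sum kappa n 1 = annular_coef kappa n.
Proof.
move=> n0; rewrite /genus_sum.
transitivity ((n.-1)`!%:R^-1 * \sum_(s : 'S_n) \sum_(t : 'S_n | transitive_pair s t &&
   (#|porbits s| + #|porbits t| == #|'I_n|)%N) orbit_prod kappa s).
  congr (_ * _); apply: eq_bigr => s _; apply: eq_bigl => t.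
  case: (boolP (transitive_pair s t)) => //= tr.
  have := connected_bound (_ : 0 < #|'I_n|)%N tr; rewrite /genus_defect card_ord => /(_ n0).
  by move: #|porbits s| #|porbits t| => a b ab; lia.
rewrite sum_annular_pairs ?card_ord // (@sum_two_cycle_perms _ _ n) ?card_ord //.
rewrite /annular_coef !big_distrr /=; apply: eq_bigr => t _.
rewrite !big_distrr /=; apply: eq_bigr => s /and3P[t0 s0 /eqP ts].
rewrite sum_marked_annular // -[_ *+ n`!]mulr_natr.
have -> : \sum_(sg in annular_nc t s) block_prod kappa (porbits sg) / (t%:R * s%:R) =
   annular_sum kappa (two_cycles t s) / (t%:R * s%:R).
  rewrite /annular_sum big_distrl /=; apply: eq_big => sg.
    by rewrite !finset.inE card_ord.
  by [].
have -> : (n`! = n * (n.-1)`!)%N by rewrite -{1}(prednK n0) factS prednK.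
rewrite natrM.
have t1 : t%:R != 0 :> R by rewrite pnatr_eq0 -lt0n.
have s1 : s%:R != 0 :> R by rewrite pnatr_eq0 -lt0n.
have := factR_neq0 R n.-1; move: ((n.-1)`!%:R) (n%:R : R) (t%:R) (s%:R) t1 s1.
move: (annular_sum _ _) => S a b c d c0 d0 a0.
by field; rewrite a0 c0 d0.
Qed.

End GenusExpansion.

(** * Real-rooted polynomials *)

Section RealRooted.
Variable R : realType.

(** Over the complex numbers every nonconstant polynomial has a root, and here all
    roots are real, so linear factors over R can be removed one at a time. *)
Lemma real_rooted_split d (p : {poly R}) : monic_real_rooted d p ->
  exists2 s : seq R, size s = d & p = \prod_(x <- s) ('X - x%:P).
Proof.
elim: d p => [|d IH] p [mp sp rp].
  exists [::] => //; rewrite big_nil; move: mp.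
  have /size_poly1P[c c0 ->] : size p == 1%N by rewrite sp.
  by rewrite monicE lead_coefC => /eqP ->.
have [z pz] : exists z : R[i], root (map_poly (real_complex R) p) z.
  by apply/closed_rootP; rewrite size_map_poly sp.
have zE : z = real_complex R (complex.Re z).
  by move: (rp z pz); case: z {pz} => a b /= ->.
move: pz; rewrite zE fmorph_root; set a := complex.Re z => /factor_theorem[q qE].
have mq : q \is monic by move: mp; rewrite qE monicMr ?monicXsubC.
have [s ss qs] : exists2 s : seq R, size s = d & q = \prod_(x <- s) ('X - x%:P).
  apply: IH; split=> //.
    by move: sp; rewrite qE size_Mmonic ?monicXsubC ?monic_neq0 // size_XsubC addn2 => -[].
  move=> w qw; apply: rp; rewrite qE rmorphM /= rootM qw //.
by exists (a :: s); rewrite /= ?ss // big_cons mulrC -qs.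
Qed.

Lemma perm_roots_with_mult (s : seq R) :
  perm_eq (roots_with_mult (\prod_(x <- s) ('X - x%:P))) s.
Proof.
set p := \prod_(x <- s) _; have p0 : p != 0 by rewrite monic_neq0 ?monic_prod_XsubC.
have rp x : (x \in rootsR p) = root p x.
  by rewrite -roots_on_rootsR // inE.
apply/allP => x _ /=; rewrite -[count_mem x s](mu_prod_XsubC) -/p; apply/eqP.
have ur : uniq (rootsR p) by exact: uniq_roots.
rewrite /roots_with_mult count_flatten -map_comp sumnE big_map.
under eq_bigr do rewrite /= count_nseq.
have [xr|xr] := boolP (x \in rootsR p).
  rewrite (bigD1_seq x) //= eqxx mul1n big1 ?addn0 // => y /negPf.
  by rewrite /= => ->.
rewrite mupNroot; last by rewrite -rp.
rewrite big1_seq // => y /andP[_ yr] /=.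
by case: eqP => //= yx; rewrite yx (negPf xr) in yr.
Qed.

Lemma sum_roots_with_mult (s : seq R) (F : R -> R) :
  \sum_(x <- roots_with_mult (\prod_(x <- s) ('X - x%:P))) F x = \sum_(x <- s) F x.
Proof. exact/perm_big/perm_roots_with_mult. Qed.

(** The polynomial with roots s, from the leading coefficient down. *)
Definition root_series (s : seq R) : fps R := \prod_(x <- s) (1 - fpsC x * fpsX R).

Lemma root_seriesE (s : seq R) n :
  root_series s n = if (n <= size s)%N then (\prod_(x <- s) ('X - x%:P))`_(size s - n) else 0.
Proof.
elim: s n => [|x s IH] n.
  by rewrite /root_series !big_nil; case: n => [|n]; rewrite /= fps1 ?coef1.
rewrite /root_series !big_cons -/(root_series s) mulrBl mul1r fpsD fpsN -mulrA fpsCM.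
case: n => [|n].
  rewrite fpsX0 mulr0 subr0 IH !subn0 /= mulrBl coefB coefXM coefCM /=.
  have -> : (\prod_(j <- s) ('X - j%:P))`_(size s).+1 = 0.
    by rewrite nth_default // size_prod_XsubC.
  by rewrite mulr0 subr0.
rewrite fpsXS !IH /= ltnS subSS mulrBl coefB coefXM coefCM.
case: ltngtP => [ns|sn|->].
- by rewrite subn_eq0 leqNgt ns /= subnS.
- by rewrite mulr0 subr0.
- by rewrite subnn /= sub0r.
Qed.

(** Newton's identities, by the product rule for w d/dw applied to the product of
    the factors 1 - x w. *)
Lemma euler_root_series (s : seq R) :
  euler (root_series s) =
  - (root_series s * ((fun n => \sum_(x <- s) x ^+ n) - fpsC (size s)%:R)).
Proof.
elim: s => [|x s IH].
  rewrite /root_series !big_nil euler1 mul1r; apply/funext => -[|n]; 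
    by rewrite fpsN fpsD fpsN big_nil /= subr0 oppr0.
rewrite /root_series !big_cons -/(root_series s) eulerM IH.
pose g : fps R := fun n => if n is n'.+1 then x ^+ n else 0.
have gE : (1 - fpsC x * fpsX R) * g = fpsC x * fpsX R.
  apply/funext => n; rewrite mulrBl mul1r fpsD fpsN -!mulrA !fpsCM.
  case: n => [|n]; first by rewrite fpsX0 /fpsX /= mulr0 subr0.
  rewrite fpsXS; case: n => [|n] /=; first by rewrite /fpsX /= mulr0 subr0 mulr1.
  by rewrite /fpsX /= mulr0 exprS subrr.
have eE : euler (1 - fpsC x * fpsX R) = - (fpsC x * fpsX R).
  apply/funext => n; rewrite /euler fpsD !fpsN fps1 !fpsCM /fpsX.
  by case: n => [|[|n]] /=; rewrite ?mul0r ?mulr0 ?subr0 ?oppr0 ?mulr0 ?mul1r ?sub0r ?mulr1.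
have pE : ((fun n => \sum_(y <- x :: s) y ^+ n) : fps R) - fpsC (size (x :: s))%:R =
   g + ((fun n => \sum_(y <- s) y ^+ n) - fpsC (size s)%:R).
  apply/funext => n; rewrite !fpsD !fpsN big_cons.
  case: n => [|n] /=; last by rewrite !subr0.
  by rewrite -natr1 expr0; ring.
rewrite pE eE -{1}gE; ring.
Qed.

(** The exact expression of the moments through the cumulants.  It holds for all
    n >= 1, also beyond the degree: for n > d the coefficients of w^d p and the
    falling factorials of d both vanish. *)
Theorem poly_moment_ff d (p : {poly R}) n : (0 < d)%N -> monic_real_rooted d p ->
  (0 < n)%N -> poly_moment d p n = ff_moment (ff_cumulant d p) d%:R n.
Proof.
move=> d0 rr; have dR : d%:R != 0 :> R by rewrite pnatr_eq0 -lt0n.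
have [s ss pE] := real_rooted_split rr; have [mp sp _] := rr.
case: n => // n _; set kap := ff_cumulant d p; set D := d%:R in dR *.
have e0 : norm_elem d p 0 = 1.
  rewrite /norm_elem subn0 bin0 mul1r divr1.
  by move: mp; rewrite monicE lead_coefE sp => /eqP.
have [c crec] := component_weight_exists e0.
have kapE k : (kap k.+1) * (- D^-1) ^+ k * k`!%:R = c k.+1.
  have cT : c k.+1 = part_sum (norm_elem d p) (@log_coef R) [set: 'I_k.+1]%SET.
    rewrite (part_sumE e0 crec) ?cardsT ?card_ord //.
    by apply/finset.set0Pn; exists ord0; rewrite finset.inE.
  rewrite /kap /ff_cumulant /=; set S := \sum_(P in _) _.
  have -> : S = c k.+1.
    rewrite cT /S /part_sum; apply: eq_big => P; first by rewrite finset.inE.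
    by [].
  have := factR_neq0 R k; move: (k`!%:R) => f f0.
  have -> : (- D^-1) ^+ k = ((- D) ^+ k)^-1 by rewrite -invrN exprVn.
  have : (- D) ^+ k != 0 by rewrite expf_neq0 // oppr_eq0.
  by move: ((- D) ^+ k) => x x0; field; rewrite f0 x0.
have suE k : sym_sum (cumulant_weight kap D) k = norm_elem d p k.
  have [m] := ubnP k; elim: m k => // m IH [|k] km; first by rewrite sym_sum0 e0.
  rewrite sym_sumS crec; apply: eq_bigr => j _; rewrite IH; last by lia.
  by rewrite /cumulant_weight kapE.
have rsE : rev_poly kap D = root_series s.
  apply/funext => k; rewrite root_seriesE -pE ss /rev_poly /rev_series suE.
  rewrite sv_prod (_ : \prod_(i < k) _ = 'C(d, k)%:R * k`!%:R); last first.
    rewrite -natrM bin_ffact ffact_prod natr_prod /D.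
    case: (leqP k d) => kd; last first.
      rewrite (bigD1 (Ordinal kd)) //= subrr mul0r.
      by rewrite (bigD1 (Ordinal kd)) //= subnn mul0r.
    by apply: eq_bigr => -[i /= ik] _; rewrite natrB //; lia.
  rewrite /norm_elem; case: leqP => kd; last by rewrite bin_small // mul0r !mulr0 mul0r.
  have b0 : 'C(d, k)%:R != 0 :> R by rewrite pnatr_eq0 -lt0n bin_gt0.
  have := factR_neq0 R k; have sq : (-1) ^+ k * (-1) ^+ k = 1 :> R.
    by rewrite -signr_odd; case: odd; ring.
  move: ('C(d, k)%:R) (k`!%:R) b0 p`_(d - k) => b f b0 x f0.
  transitivity (((-1) ^+ k * (-1) ^+ k) * x); last by rewrite sq mul1r.
  by move: ((-1) ^+ k) => y; field; rewrite b0 f0.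
apply/esym; apply: (@ff_moment_unique _ kap D dR (poly_moment d p)).
have m0 : poly_moment d p 0 = 1.
  by rewrite /poly_moment pE sum_roots_with_mult big_const_seq count_predT ss iter_addr_0 mulVf.
apply: (proj2 (newton_euler dR (fun n => sym_sum (cumulant_weight kap D) n *
  sym_sum (falling_weight D) n) m0)); rewrite -/(rev_poly kap D) rsE euler_root_series.
congr (- _); rewrite mulrCA; congr (_ * _); apply/funext => k.
rewrite fpsD fpsN fpsCM fpsD fpsN fps1 /poly_moment pE sum_roots_with_mult mulrBr mulVKf //.
by congr (_ - _); case: k => [|k]; rewrite /= ?mulr0 ?mulr1 ?ss.
Qed.

End RealRooted.

Local Open Scope classical_set_scope.

(** * Limits and first-order fluctuations of real sequences *)

Section Sequences.
Variable R : realType.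
Implicit Types (u v : nat -> R).

Lemma cvg_sum_seq (I : Type) (r : seq I) (P : pred I) (F : I -> nat -> R) (l : I -> R) :
  (forall i, P i -> F i @ \oo --> l i) ->
  (fun d => \sum_(i <- r | P i) F i d) @ \oo --> \sum_(i <- r | P i) l i.
Proof.
move=> Fl; elim: r => [|i r IH].
  rewrite big_nil (_ : (fun d => _) = (fun=> 0)); first exact: cvg_cst.
  by apply/funext => d; rewrite big_nil.
rewrite big_cons; case: (boolP (P i)) => Pi; last first.
  rewrite (_ : (fun d => _) = (fun d => \sum_(j <- r | P j) F j d)) //.
  by apply/funext => d; rewrite big_cons (negPf Pi).
rewrite (_ : (fun d => _) = (F i \+ fun d => \sum_(j <- r | P j) F j d)).
  exact: cvgD (Fl i Pi) IH.
by apply/funext => d; rewrite big_cons Pi.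
Qed.

Lemma cvg_exp_seq u (l : R) g : u @ \oo --> l -> (fun d => u d ^+ g) @ \oo --> l ^+ g.
Proof.
move=> ul; elim: g => [|g IH]; first exact: cvg_cst.
rewrite exprS (_ : (fun d => _) = u \* (fun d => u d ^+ g)); first exact: cvgM.
by apply/funext => d; rewrite exprS.
Qed.

Lemma cvg_mul_seq u v (a b : R) : u @ \oo --> a -> v @ \oo --> b ->
  (fun d => u d * v d) @ \oo --> a * b.
Proof. exact: cvgM. Qed.

Lemma cvg_eq_lim u (a b : R) : u @ \oo --> a -> u @ \oo --> b -> a = b.
Proof. by move=> ua ub; rewrite -(cvg_lim _ ua) // -(cvg_lim _ ub). Qed.

Lemma cvg_inv_succ : (fun d => (d.+1)%:R^-1 : R) @ \oo --> (0 : R).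
Proof. exact: cvg_harmonic. Qed.

End Sequences.

(** * The leading order *)

Section LeadingOrder.
Variables (R : realType) (kappa : nat -> R).

(** The moment of order n in the limit of infinite degree with kappa fixed. *)
Definition leading_moment (n : nat) : R :=
  if n is 0%N then 1 else genus_sum kappa n 0.

Local Notation mom d := (ff_moment kappa (d.+1)%:R).
Local Notation G := (cauchy_series leading_moment : fps R).

Lemma cvg_ff_moment n : (fun d => mom d n) @ \oo --> leading_moment n.
Proof.
case: n => [|n]; first exact: cvg_cst.
have -> : (fun d => mom d n.+1) =
    (fun d => \sum_(g < n.+3) (- (d.+1)%:R^-1) ^+ g * genus_sum kappa n.+1 g).
  by apply/funext => d; rewrite ff_moment_genus // pnatr_eq0.
have -> : leading_moment n.+1 = \sum_(g < n.+3) (- 0) ^+ g * genus_sum kappa n.+1 g.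
  rewrite big_ord_recl /= expr0 mul1r big1 ?addr0 // => i _.
  by rewrite oppr0 expr0n mul0r.
apply: cvg_sum_seq => g _; apply: cvg_mul_seq; last exact: cvg_cst.
by apply: cvg_exp_seq; apply: cvgN; apply: cvg_inv_succ.
Qed.

Lemma cvg_cauchy_series n : (fun d => cauchy_series (mom d) n) @ \oo --> G n.
Proof. by case: n => [|n]; [exact: cvg_cst|exact: cvg_ff_moment]. Qed.

(** The derivative in the recursion of Q_k carries a factor 1/D, so only the powers
    of G survive. *)
Lemma cvg_log_deriv_iter k n :
  (fun d => log_deriv_iter (d.+1)%:R (cauchy_series (mom d)) k n) @ \oo --> (G ^+ k) n.
Proof.
elim: k n => [|k IH] n; first exact: cvg_cst.
rewrite (_ : (fun d => _) = (fun d =>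
  \sum_(i < n.+1) cauchy_series (mom d) i * log_deriv_iter (d.+1)%:R (cauchy_series (mom d)) k (n - i)%N
  + (d.+1)%:R^-1 * dz (log_deriv_iter (d.+1)%:R (cauchy_series (mom d)) k) n)); last first.
  by apply/funext => d; rewrite /= fpsD fpsCM.
rewrite -[X in _ --> X]addr0; apply: cvgD.
  rewrite exprS fpsM; apply: cvg_sum_seq => i _.
  by apply: cvg_mul_seq; [exact: cvg_cauchy_series|exact: IH].
rewrite -(mul0r (dz (G ^+ k) n)); apply: cvg_mul_seq; first exact: cvg_inv_succ.
case: n => [|n]; first exact: cvg_cst.
rewrite /dz /=; apply: cvgN; apply: cvg_mul_seq; [exact: cvg_cst|exact: IH].
Qed.

Lemma leading_equation N :
  eq_upto N G (fpsX R * (1 + \sum_(k < N) fpsC (kappa k.+1) * G ^+ k.+1)).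
Proof.
move=> n nN; apply: (cvg_eq_lim (cvg_cauchy_series (n := n))).
have D0 d : (d.+1)%:R != 0 :> R by rewrite pnatr_eq0.
have loop d := loop_equation kappa (D0 d) nN.
rewrite (_ : (fun d => _) = (fun d => (fpsX R * (1 + \sum_(k < N) fpsC (kappa k.+1) *
   log_deriv_iter (d.+1)%:R (cauchy_series (mom d)) k.+1)) n)); last first.
  by apply/funext => d; apply: loop.
case: n nN {loop} => [|n] nN.
  rewrite (_ : (fun d => _) = (fun=> 0)); first by rewrite fpsX0; exact: cvg_cst.
  by apply/funext => d; rewrite fpsX0.
rewrite fpsXS fpsD fps_sum (_ : (fun d => _) = (fun d => (1 : fps R) n +
  \sum_(k < N) kappa k.+1 * log_deriv_iter (d.+1)%:R (cauchy_series (mom d)) k.+1 n)).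
  apply: cvgD; first exact: cvg_cst.
  apply: cvg_sum_seq => k _; rewrite fpsCM.
  by apply: cvg_mul_seq; [exact: cvg_cst|exact: cvg_log_deriv_iter].
apply/funext => d; rewrite fpsXS fpsD fps_sum; congr (_ + _).
by apply: eq_bigr => k _; rewrite fpsCM.
Qed.

(** The auxiliary numbers required by the recursion of non-crossing partitions are
    the coefficients of sum_j kappa_(k+j) G^j: these series B_k satisfy
    B_k = kappa_(k+1) G + G B_(k+1). *)
Lemma leading_momentE (m : nat) (D : {set 'I_m}) :
  nc_sum kappa D = leading_moment #|D|.
Proof.
have G0 : G 0%N = 0 by [].
pose A k n := (\sum_(j < n.+1) fpsC (kappa (k + j).+1) * G ^+ j.+1) n.+1.
apply: (@nc_sumE R m kappa leading_moment A) => // [n|k n].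
  have /= -> := leading_equation (leqnn n.+2).
  rewrite fpsXS fpsD fps1 add0r big_ord_recr /= fpsD fpsCM (@order_exp R _ n.+2) //.
  by rewrite mulr0 addr0.
rewrite /A big_ord_recl fpsD fpsCM addn0 /= expr1; congr (_ + _).
have -> : \sum_(i < n) fpsC (kappa (k + bump 0 i).+1) * G ^+ (bump 0 i).+1 =
   G * \sum_(i < n) fpsC (kappa (k.+1 + i).+1) * G ^+ i.+1.
  rewrite big_distrr; apply: eq_bigr => i _ /=; rewrite /bump /= add1n addnS addSn.
  by rewrite [G ^+ _.+2]exprS mulrCA.
rewrite fpsM big_ord_recl /= mul0r add0r big_ord_recr /= subnn.
rewrite [X in _ * X](_ : _ = 0); last first.
  rewrite fps_sum big1 // => i _; rewrite fpsCM order_exp ?mulr0 //.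
rewrite mulr0 addr0 (reindex_inj rev_ord_inj) /=; apply: eq_bigr => i _.
rewrite /bump /= add1n subSS; have -> : (n - (n - i.+1) = i.+1)%N by case: i => i /= ?; lia.
rewrite mulrC; congr (_ * _); rewrite !fps_sum.
rewrite [RHS](big_ord_widen n (fun j => (fpsC (kappa (k.+1 + j).+1) * G ^+ j.+1) i.+1)) //.
rewrite [RHS]big_mkcond /=; apply: eq_bigr => j _; case: ifP => // ji.
by rewrite fpsCM order_exp ?mulr0 //; lia.
Qed.

Lemma genus0_noncrossing n : (0 < n)%N ->
  genus_sum kappa n 0 = \sum_(P in nc_partitions n) block_prod kappa P.
Proof.
case: n => // n _; have := leading_momentE [set: 'I_n.+1]%SET.
rewrite cardsT card_ord /= => <-; apply: eq_bigl => P.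
by rewrite !finset.inE.
Qed.

End LeadingOrder.

(** * First-order fluctuations *)

Section Fluctuations.
Variable R : realType.
Implicit Types (X Y : nat -> R) (x y : R).

(** X_d = x + x'/d + o(1/d).  These pairs (x, x') multiply like dual numbers. *)
Definition fluct X x x' := (fun d => d%:R * (X d - x)) @ \oo --> (x' : R).

(** The term d = 0 is multiplied by 0, so X and Y may differ there. *)
Lemma eq_fluct X Y x x' : (forall d, (0 < d)%N -> X d = Y d) ->
  fluct X x x' -> fluct Y x x'.
Proof.
move=> XY; rewrite /fluct; suff -> : (fun d => d%:R * (X d - x)) = (fun d => d%:R * (Y d - x)) by [].
by apply/funext => -[|d]; rewrite ?mul0r // XY.
Qed.

Lemma fluct_unique X x x1 x2 : fluct X x x1 -> fluct X x x2 -> x1 = x2.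
Proof. exact: cvg_eq_lim. Qed.

Lemma fluct_cvg X x x' : fluct X x x' -> X @ \oo --> x.
Proof.
move=> Xx; rewrite -cvg_shiftS.
have Xs : (fun d => (d.+1)%:R * (X d.+1 - x)) @ \oo --> x'.
  by move: Xx; rewrite /fluct -cvg_shiftS.
rewrite (_ : (fun d => _) = (fun d => x + (d.+1)%:R^-1 * ((d.+1)%:R * (X d.+1 - x)))).
  suff: (fun d => x + (d.+1)%:R^-1 * ((d.+1)%:R * (X d.+1 - x))) @ \oo --> x + 0 * x'.
    by rewrite mul0r addr0.
  apply: cvgD; first exact: cvg_cst.
  by apply: cvg_mul_seq => //; exact: cvg_inv_succ.
by apply/funext => d; rewrite mulKf ?pnatr_eq0 // addrC subrK.
Qed.

Lemma fluct_cst x : fluct (fun=> x) x 0.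
Proof.
rewrite /fluct (_ : (fun d => _) = (fun=> 0)); first exact: cvg_cst.
by apply/funext => d; rewrite subrr mulr0.
Qed.

Lemma fluctD X Y x y x' y' : fluct X x x' -> fluct Y y y' ->
  fluct (fun d => X d + Y d) (x + y) (x' + y').
Proof.
move=> Xx Yy; rewrite /fluct (_ : (fun d => _) =
  (fun d => d%:R * (X d - x) + d%:R * (Y d - y))); first exact: cvgD.
by apply/funext => d; ring.
Qed.

Lemma fluctM X Y x y x' y' : fluct X x x' -> fluct Y y y' ->
  fluct (fun d => X d * Y d) (x * y) (x' * y + x * y').
Proof.
move=> Xx Yy; rewrite /fluct (_ : (fun d => _) =
  (fun d => d%:R * (X d - x) * Y d + x * (d%:R * (Y d - y)))); last first.
  by apply/funext => d; ring.
apply: cvgD; first exact: cvg_mul_seq (fluct_cvg Yy).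
by apply: cvg_mul_seq => //; exact: cvg_cst.
Qed.

Lemma fluct_sum (I : Type) (r : seq I) (P : pred I) (F : I -> nat -> R) (l l' : I -> R) :
  (forall i, P i -> fluct (F i) (l i) (l' i)) ->
  fluct (fun d => \sum_(i <- r | P i) F i d) (\sum_(i <- r | P i) l i)
    (\sum_(i <- r | P i) l' i).
Proof.
move=> Fl; rewrite /fluct (_ : (fun d => _) =
  (fun d => \sum_(i <- r | P i) d%:R * (F i d - l i))); first exact: cvg_sum_seq.
by apply/funext => d; rewrite -sumrB big_distrr.
Qed.

Definition has_fluct X x := exists x', fluct X x x'.

Lemma has_fluct_prod (I : Type) (r : seq I) (P : pred I) (F : I -> nat -> R) (l : I -> R) :
  (forall i, P i -> has_fluct (F i) (l i)) ->
  has_fluct (fun d => \prod_(i <- r | P i) F i d) (\prod_(i <- r | P i) l i).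
Proof.
move=> Fl; elim: r => [|i r [x' IH]].
  by exists 0; rewrite big_nil; apply: eq_fluct (fluct_cst 1) => d _; rewrite big_nil.
rewrite big_cons; case: (boolP (P i)) => Pi; last first.
  by exists x'; apply: eq_fluct IH => d _; rewrite big_cons (negPf Pi).
have [y' iy] := Fl i Pi; eexists; apply: eq_fluct (fluctM iy IH) => d _.
by rewrite big_cons Pi.
Qed.

Lemma has_fluct_sum (I : eqType) (r : seq I) (P : pred I) (F : I -> nat -> R) (l : I -> R) :
  (forall i, P i -> has_fluct (F i) (l i)) ->
  has_fluct (fun d => \sum_(i <- r | P i) F i d) (\sum_(i <- r | P i) l i).
Proof.
move=> Fl; elim: r => [|i r [x' IH]].
  by exists 0; rewrite big_nil; apply: eq_fluct (fluct_cst 0) => d _; rewrite big_nil.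
rewrite big_cons; case: (boolP (P i)) => Pi; last first.
  by exists x'; apply: eq_fluct IH => d _; rewrite big_cons (negPf Pi).
have [y' iy] := Fl i Pi; eexists; apply: eq_fluct (fluctD iy IH) => d _.
by rewrite big_cons Pi.
Qed.

Lemma has_fluctM X Y x y : has_fluct X x -> has_fluct Y y ->
  has_fluct (fun d => X d * Y d) (x * y).
Proof. by move=> [x' Xx] [y' Yy]; eexists; exact: fluctM Xx Yy. Qed.

Lemma has_fluct_div X Y x y : y != 0 -> has_fluct X x -> has_fluct Y y ->
  has_fluct (fun d => X d / Y d) (x / y).
Proof.
move=> y0 [x' Xx] [y' Yy]; apply: has_fluctM; first by exists x'.
have Ycvg := fluct_cvg Yy; exists (- (y' * y^-1 * y^-1)).
have Yne : \forall d \near \oo, Y d != 0 by apply: cvgr_neq0 Ycvg y0.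
have h : (fun d => - (d%:R * (Y d - y) * (Y d)^-1 * y^-1)) @ \oo --> - (y' * y^-1 * y^-1).
  apply: cvgN; apply: cvg_mul_seq; last exact: cvg_cst.
  by apply: cvg_mul_seq => //; exact: cvgV.
apply: cvg_trans h; apply: near_eq_cvg; near=> d.
have Yd : Y d != 0 by near: d.
by field; rewrite y0 Yd.
Unshelve. all: by end_near. Qed.

Lemma fluct_inv : fluct (fun d => - d%:R^-1) 0 (-1).
Proof.
rewrite /fluct -cvg_shiftS (_ : [sequence _]_n = (fun=> -1)); first exact: cvg_cst.
by apply/funext => d /=; rewrite subr0 mulrN mulfV ?pnatr_eq0.
Qed.

Lemma fluct_inv_pow g : fluct (fun d => (- d%:R^-1) ^+ g) (0 ^+ g) (- (g == 1%N)%:R).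
Proof.
elim: g => [|g IH]; first by rewrite oppr0; exact: fluct_cst.
rewrite exprS; have := fluctM fluct_inv IH.
rewrite [0 * - _]mul0r addr0 mulN1r expr0n eqSS.
by apply: eq_fluct => d _; rewrite exprS.
Qed.

End Fluctuations.

(** * Fluctuations of moments and of cumulants *)

Section Asymptotics.
Variable R : realType.
Implicit Types (K : nat -> nat -> R) (r : nat -> R).

Definition fluct_upto K r (n : nat) :=
  forall j, (0 < j <= n)%N -> has_fluct (fun d => K d j) (r j).

Lemma porbit_size (T : finType) (s : {perm T}) (c : {set T}) :
  c \in porbits s -> (0 < #|c| <= #|T|)%N.
Proof. by case/imsetP => x _ ->; rewrite lt0n card_porbit_neq0 max_card. Qed.

Lemma has_fluct_genus_sum K r n g : fluct_upto K r n ->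
  has_fluct (fun d => genus_sum (K d) n g) (genus_sum r n g).
Proof.
move=> Kr; apply: has_fluctM; first by eexists; apply: fluct_cst.
apply: has_fluct_sum => s _; apply: has_fluct_sum => t _.
apply: has_fluct_prod => c /porbit_size; rewrite card_ord; exact: Kr.
Qed.

Definition moment_expansion K n d : R :=
  \sum_(g < n.+2) (- d%:R^-1) ^+ g * genus_sum (K d) n g.

(** Only the genus-0 term fluctuates by itself; the next one is divided by -d and
    contributes its limit. *)
Lemma fluct_moment_expansion K r n delta : (0 < n)%N -> fluct_upto K r n ->
  fluct (fun d => genus_sum (K d) n 0) (genus_sum r n 0) delta ->
  fluct (moment_expansion K n) (genus_sum r n 0) (delta - annular_coef r n).
Proof.
move=> n0 Kr F0.
have /choice[f Hf] : forall g, exists x', fluct (fun d => genus_sum (K d) n g) (genus_sum r n g) x'.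
  by move=> g; exact: has_fluct_genus_sum.
have -> : delta = f 0%N by exact: fluct_unique F0 (Hf 0%N).
have := @fluct_sum R 'I_n.+2 (index_enum 'I_n.+2) xpredT
  (fun g d => (- d%:R^-1) ^+ g * genus_sum (K d) n g)
  (fun g => 0 ^+ g * genus_sum r n g)
  (fun g => (- (g == 1%N :> nat)%:R) * genus_sum r n g + 0 ^+ g * f g)
  (fun g _ => fluctM (@fluct_inv_pow R g) (Hf g)).
rewrite [X in fluct _ X _]big_ord_recl expr0 mul1r [X in _ + X]big1 ?addr0; last first.
  by move=> i _; rewrite expr0n mul0r.
rewrite [X in fluct _ _ X]big_ord_recl [X in _ + X]big_ord_recl /= [X in _ + (_ + X)]big1; last first.
  by move=> i _; rewrite /bump /= expr0n /= oppr0 !mul0r addr0.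
rewrite oppr0 mul0r add0r mul1r addr0 expr0n /= mul0r addr0 mulN1r.
by rewrite genus_sum_annular.
Qed.

(** The top cumulant kappa_n occurs only in cyclic permutations, and linearly. *)
Lemma orbit_prod_top (kappa : nat -> R) n (s : 'S_n) : (0 < n)%N ->
  orbit_prod kappa s = orbit_prod (fun j => if j == n then 0 else kappa j) s +
    orbit_prod (fun j => (j == n)%:R) s * kappa n.
Proof.
move=> n0; rewrite /orbit_prod.
have [/imsetP[x _ pT]|nT] := boolP ([set: 'I_n]%SET \in porbits s).
  have E : porbits s = [set [set: 'I_n]]%SET.
    apply/setP => c; rewrite finset.in_set1; apply/imsetP/eqP => [[y _ ->]|->]; last by exists x.
    by rewrite pT; apply/eqP; rewrite eq_porbit_mem -pT finset.inE.
  by rewrite E !big_set1 cardsT card_ord eqxx add0r mul1r.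
have ne c : c \in porbits s -> (#|c| == n) = false.
  move=> cs; apply/negP => cn; case/negP: nT.
  have -> // : [set: 'I_n]%SET = c.
  by apply/eqP; rewrite eq_sym finset.eqEcard finset.subsetT cardsT card_ord (eqP cn) leqnn.
have [c cs] : exists c, c \in porbits s by exists (porbit s (Ordinal n0)); apply: imset_f.
rewrite [X in _ + X * _](bigD1 c) //= ne // mul0r mul0r addr0.
by apply: eq_bigr => b bs; rewrite ne.
Qed.

Lemma genus_sum_top (kappa : nat -> R) n g : (0 < n)%N ->
  genus_sum kappa n g = genus_sum (fun j => if j == n then 0 else kappa j) n g +
    genus_sum (fun j => (j == n)%:R) n g * kappa n.
Proof.
move=> n0; rewrite /genus_sum -mulrA -mulrDr; congr (_ * _).
rewrite big_distrl -big_split; apply: eq_bigr => s _ /=.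
rewrite big_distrl -big_split; apply: eq_bigr => t _ /=.
exact: orbit_prod_top.
Qed.

Lemma genus0_top_neq0 n : (0 < n)%N -> genus_sum (fun j => (j == n)%:R) n 0 != 0 :> R.
Proof.
case: n => // n _; rewrite genus0_noncrossing //.
have T0 : [set: 'I_n.+1]%SET != finset.set0.
  by apply/finset.set0Pn; exists ord0; rewrite finset.in_setT.
have inT : [set [set: 'I_n.+1]]%SET \in nc_partitions n.+1.
  rewrite !finset.inE; apply/andP; split.
    rewrite /finset.partition /finset.trivIset /finset.cover !big_set1 !eqxx /=.
    by rewrite finset.in_set1 eq_sym T0.
  by apply/noncrossingP => V W i j k l; rewrite !finset.in_set1 => /eqP -> /eqP ->.
rewrite (bigD1 _ inT) /= {1}/block_prod big_set1 cardsT card_ord eqxx.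
apply: lt0r_neq0; apply: ltr_wpDr; rewrite ?ltr01 //.
by apply: sumr_ge0 => P _; apply: prodr_ge0 => V _; exact: ler0n.
Qed.

(** By strong induction: the moment is linear in the top cumulant, with a coefficient
    that has a nonzero limit, and the other terms involve smaller cumulants only.
    Dividing by the coefficient preserves fluctuations. *)
Lemma has_fluct_cumulant K r (m : nat -> R) n :
  (forall j, (0 < j)%N -> m j = genus_sum r j 0) ->
  (forall j, (0 < j)%N -> has_fluct (moment_expansion K j) (m j)) ->
  (0 < n)%N -> has_fluct (fun d => K d n) (r n).
Proof.
move=> mr mK; have [N] := ubnP n; elim: N n => // N IH n; rewrite ltnS => nN n0.
(* The moment is its value at [cut K], where the top cumulant is 0, plus the top
   cumulant times its value at [top]. *)
pose cut (kap : nat -> R) := fun j => if j == n then 0 else kap j.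
pose top : nat -> R := fun j => (j == n)%:R.
have Kcut : fluct_upto (fun d => cut (K d)) (cut r) n.
  move=> j /andP[j0 jn]; rewrite /cut; have [_|jn'] := eqVneq j n.
    by eexists; exact: fluct_cst.
  by apply: IH => //; lia.
have Ktop : fluct_upto (fun _ => top) top n by move=> j _; eexists; exact: fluct_cst.
have [xc Hc] := has_fluct_genus_sum 0 Kcut; have [xt Ht] := has_fluct_genus_sum 0 Ktop.
have Fc := fluct_moment_expansion n0 Kcut Hc; have Ft := fluct_moment_expansion n0 Ktop Ht.
have t0 := genus0_top_neq0 n0.
have -> : r n = (m n - genus_sum (cut r) n 0) / genus_sum top n 0.
  by rewrite mr // (genus_sum_top r 0 n0) -/(cut r) addrC addKr mulrC mulKf.
have [x' Hx] : has_fluct (fun d => (moment_expansion K n d - moment_expansion (fun d => cut (K d)) n d)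
   / moment_expansion (fun=> top) n d) ((m n - genus_sum (cut r) n 0) / genus_sum top n 0).
  apply: has_fluct_div => //; last by eexists; exact: Ft.
  have [y' Hy] := mK n n0; have := fluctM (fluct_cst (-1)) Fc; rewrite mulN1r => H1.
  by eexists; apply: eq_fluct (fluctD Hy H1) => d _; rewrite mulN1r.
have E d : moment_expansion K n d = moment_expansion (fun d => cut (K d)) n d +
    moment_expansion (fun=> top) n d * K d n.
  rewrite /moment_expansion big_distrl -big_split; apply: eq_bigr => g _ /=.
  by rewrite (genus_sum_top (K d) g n0) mulrDr; congr (_ + _); exact: mulrA.
have Tne : \forall d \near \oo, moment_expansion (fun=> top) n d != 0.
  by apply: cvgr_neq0 (fluct_cvg Ft) t0.
exists x'; apply: cvg_trans Hx; apply: near_eq_cvg; near=> d.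
congr (_ * (_ - _)); rewrite E addrC addKr mulrC mulKf //.
by near: d.
Unshelve. all: by end_near. Qed.

End Asymptotics.

(** * The linearised equation *)

Section Linearisation.
Variable R : realType.
Implicit Types (f g : fps R).

Lemma dzX (f : fps R) k : dz (f ^+ k.+1) = f ^+ k * dz f *+ k.+1.
Proof.
elim: k => [|k IH]; first by rewrite !expr1 expr0 mul1r mulr1n.
rewrite exprS dzM IH mulrnAr mulrA -exprS [RHS]mulrSr addrC.
by congr (_ + _); exact: mulrC.
Qed.

Lemma dzD f g : dz (f + g) = dz f + dz g.
Proof. by rewrite !dzE eulerD; ring. Qed.

Lemma dz_sum (I : Type) (r : seq I) (P : pred I) (F : I -> fps R) :
  dz (\sum_(i <- r | P i) F i) = \sum_(i <- r | P i) dz (F i).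
Proof.
elim/big_rec2: _ => [|i x y _ <-]; last by rewrite dzD.
by apply/funext => -[|n]; rewrite dzE fpsN ?fpsX0 ?fpsXS /euler ?fps0 ?mulr0 oppr0.
Qed.

Lemma dz_upto N f g : eq_upto N f g -> eq_upto N (dz f) (dz g).
Proof. by move=> fg [|n] nN //=; rewrite /dz /= fg // ltnW. Qed.

Definition fluct_series (F : nat -> fps R) f f' := forall n, fluct (fun d => F d n) (f n) (f' n).

Lemma fluct_seriesM (F H : nat -> fps R) f f' g g' :
  fluct_series F f f' -> fluct_series H g g' ->
  fluct_series (fun d => F d * H d) (f * g) (f' * g + f * g').
Proof.
move=> Ff Hg n; rewrite fpsD !fpsM -big_split /=.
by apply: fluct_sum => i _; exact: fluctM.
Qed.

Lemma fluct_seriesX (F : nat -> fps R) f f' k : fluct_series F f f' ->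
  fluct_series (fun d => F d ^+ k.+1) (f ^+ k.+1) (f ^+ k * f' *+ k.+1).
Proof.
move=> Ff; elim: k => [|k IH].
  by move=> n; rewrite expr1 expr0 mul1r mulr1n; apply: eq_fluct (Ff n) => d _; rewrite expr1.
move=> n; have /(_ n) := fluct_seriesM Ff IH; rewrite -exprS.
have -> : f' * f ^+ k.+1 + f * (f ^+ k * f' *+ k.+1) = f ^+ k.+1 * f' *+ k.+2.
  rewrite mulrnAr mulrA -exprS [RHS]mulrSr addrC.
  by congr (_ + _); exact: mulrC.
by apply: eq_fluct => d _; rewrite -exprS.
Qed.

Lemma fluct_seriesC (K : nat -> R) x x' : fluct K x x' ->
  fluct_series (fun d => fpsC (K d)) (fpsC x) (fpsC x').
Proof. by move=> Kx [|n] //=; exact: fluct_cst. Qed.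

Lemma fluct_series_sum (I : Type) (s : seq I) (F : I -> nat -> fps R) (f f' : I -> fps R) :
  (forall i, fluct_series (F i) (f i) (f' i)) ->
  fluct_series (fun d => \sum_(i <- s) F i d) (\sum_(i <- s) f i) (\sum_(i <- s) f' i).
Proof.
move=> Ff n; rewrite !fps_sum; apply: eq_fluct (fluct_sum _) => [d _|i _].
  by rewrite fps_sum.
exact: Ff.
Qed.

Lemma fluct_series_cst f : fluct_series (fun=> f) f 0.
Proof. by move=> n; exact: fluct_cst. Qed.

(** Let S' = sum_k k r_k g^(k-1).  Differentiating g = w (1 + sum_k r_k g^k) along
    the fluctuations gives (1 - w S') g' = w g Rhat(g), and differentiating it in z
    gives (1 - w S') dz g = - w g.  Since 1 - w S' is invertible,
    g' = - Rhat(g) dz g. *)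
Lemma linearised_equation (K : nat -> nat -> R) (r rho : nat -> R) (F : nat -> fps R) g g' :
  (forall n, (0 < n)%N -> fluct (fun d => K d n) (r n) (rho n)) ->
  fluct_series F g g' ->
  (forall N d, eq_upto N (F d)
     (fpsX R * (1 + \sum_(k < N) fpsC (K d k.+1) * F d ^+ k.+1))) ->
  (forall N, eq_upto N g (fpsX R * (1 + \sum_(k < N) fpsC (r k.+1) * g ^+ k.+1))) ->
  g 0%N = 0 ->
  g' = - (fps_comp (R_series rho) g : fps R) * dz g.
Proof.
move=> Kr Fg eqF eqg g0; apply/funext => n; set N := n.+1.
pose S' : fps R := \sum_(k < N) fpsC (r k.+1) * g ^+ k *+ k.+1.
pose Rh : fps R := \sum_(k < N) fpsC (rho k.+1) * g ^+ k.
have eRh : eq_upto n (fps_comp (R_series rho) g) Rh.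
  move=> m mn; rewrite /Rh fps_sum /fps_comp.
  rewrite (big_ord_widen N (fun k => R_series rho k * fps_pow g k m)) ?ltnS //.
  rewrite big_mkcond /=; apply: eq_bigr => k _; rewrite fpsCM fps_powE.
  by case: ifP => // km; rewrite order_exp ?mulr0 //; lia.
have e1 : eq_upto N g' (fpsX R * (Rh * g + S' * g')).
  move=> m mN; apply: fluct_unique (Fg m) _.
  have -> : fpsX R * (Rh * g + S' * g') =
     0 * (1 + \sum_(k < N) fpsC (r k.+1) * g ^+ k.+1) + fpsX R * (0 + \sum_(k < N)
     (fpsC (rho k.+1) * g ^+ k.+1 + fpsC (r k.+1) * (g ^+ k * g' *+ k.+1))).
    rewrite mul0r !add0r big_split /= /Rh /S' !big_distrl /=; congr (_ * (_ + _)).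
      by apply: eq_bigr => k _; rewrite exprSr mulrA.
    by apply: eq_bigr => k _; rewrite mulrnAl mulrnAr mulrA.
  rewrite (eqg N m mN); apply: eq_fluct (fluct_seriesM (fluct_series_cst (fpsX R)) _ (n := m)).
    by move=> d _; apply/esym/(eqF N d m mN).
  move=> i; rewrite !fpsD; apply: fluctD; first exact: fluct_cst.
  apply: (@fluct_series_sum _ _ (fun (k : 'I_N) d => fpsC (K d k.+1) * F d ^+ k.+1)) => k.
  by apply: fluct_seriesM; [apply/fluct_seriesC/Kr|exact: fluct_seriesX].
have dzXX : dz (fpsX R) = - (fpsX R * fpsX R) by rewrite dzE eulerX.
have e2 : eq_upto N (dz g) (- (fpsX R * g) + fpsX R * S' * dz g).
  have E : dz (fpsX R * (1 + \sum_(k < N) fpsC (r k.+1) * g ^+ k.+1)) =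
     - (fpsX R * (fpsX R * (1 + \sum_(k < N) fpsC (r k.+1) * g ^+ k.+1))) + fpsX R * S' * dz g.
    have dS : dz (\sum_(k < N) fpsC (r k.+1) * g ^+ k.+1) = S' * dz g.
      rewrite dz_sum /S' big_distrl /=; apply: eq_bigr => k _.
      rewrite dzM dzX [dz (fpsC _)]dzE eulerC mulr0 oppr0 mul0r add0r.
      by rewrite mulrnAl mulrnAr mulrA.
    by rewrite dzM dzXX dzD dS [dz 1]dzE euler1 mulr0 oppr0 add0r; ring.
  move=> m mN; rewrite (dz_upto (eqg N)) // E fpsD fpsN [in RHS]fpsD [in RHS]fpsN.
  congr (- _ + _); apply: (eq_uptoM (N := N)) => //; first by move=> i iN; apply/esym/(eqg N).
have key : eq_upto N ((1 - fpsX R * S') * (g' + Rh * dz g)) 0.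
  move=> m mN; have -> : (1 - fpsX R * S') * (g' + Rh * dz g) =
    (g' - fpsX R * (Rh * g + S' * g')) +
    Rh * (dz g - (- (fpsX R * g) + fpsX R * S' * dz g)) by ring.
  rewrite fpsD fpsD fpsN -e1 // subrr add0r.
  rewrite (eq_uptoM (N := N) (f' := Rh) (g' := 0)) ?mulr0 //.
  by move=> i iN; rewrite fpsD fpsN -e2 // subrr.
have c1 : (1 - fpsX R * S') 0%N = 1 by rewrite fpsD fpsN fpsX0 subr0 fps1.
have := regular_upto c1 key (leqnSn n); rewrite fpsD fps0 => /eqP.
rewrite addr_eq0 => /eqP ->; rewrite mulNr fpsN; congr (- _).
by apply/esym; apply: (eq_uptoM (N := n)).
Qed.

End Linearisation.

(** * Moments of the infinitesimal distribution *)

Lemma fluct_littleo (R : realType) (X : nat -> R) (x x' : R) :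
  ((X : nat -> R^o) = (fun d => x + d%:R^-1 * x' : R^o) +o_\oo (fun d => d%:R^-1 : R^o)) <->
  fluct X x x'.
Proof.
have key d : (0 < d)%N -> x' - d%:R * (X d - x) = - (d%:R * (X d - (x + d%:R^-1 * x'))).
  move=> d0; have dn0 : d%:R != 0 :> R by rewrite pnatr_eq0 -lt0n.
  by field; rewrite dn0.
split=> [/eqaddoP h|h].
  apply/cvgrPdist_le => e e0; have := h e e0; move=> he; near=> d.
  have d0 : (0 < d)%N by near: d; exact: nbhs_infty_gt.
  rewrite key // normrN normrM.
  have : `|X d - (x + d%:R^-1 * x')| <= e * `|d%:R^-1| by near: d.
  have dp : 0 < d%:R :> R by rewrite ltr0n.
  rewrite normfV (ger0_norm (ltW dp)) => le.
  by rewrite -ler_pdivlMl // [_ * e]mulrC.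
apply/eqaddoP => e e0; move/cvgrPdist_le : h => /(_ e e0) he; near=> d.
have d0 : (0 < d)%N by near: d; exact: nbhs_infty_gt.
have : `|x' - d%:R * (X d - x)| <= e by near: d.
have dp : 0 < d%:R :> R by rewrite ltr0n.
rewrite key // normrN normrM (ger0_norm (ltW dp)) => le.
rewrite /= normfV (ger0_norm (ltW dp)).
by rewrite [e * _]mulrC ler_pdivlMl.
Unshelve. all: by end_near. Qed.

Theorem lemma4p3 (R : realType) (p : nat -> {poly R})
    (mu : probability (measurableTypeR R) R) (mu' : {scalar {poly R}})
    (p_real_rooted : forall d, (0 < d)%N -> monic_real_rooted d (p d))
    (p_distr : infinitesimal_distribution p mu mu') :
  (exists rhat : nat -> R, cumulant_fluctuations p mu rhat) /\
  (forall rhat : nat -> R, cumulant_fluctuations p mu rhat ->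
    let G_mu := cauchy_series (moment mu) in
    let G_mu' := cauchy_series (fun n => mu' 'X^n) in
    let Rhat := R_series rhat in
    let H_mu := annular_series (free_cumulant (moment mu)) in
    G_mu' = - fps_mul (fps_comp Rhat G_mu) (fps_deriv_inv G_mu) - H_mu).
Proof.
have [_ mom_lim mu'1 mom_fluct] := p_distr.
set m := moment mu; set r := free_cumulant m.
pose K d := ff_cumulant d (p d).
have m0 : m 0%N = 1.
  apply: (cvg_eq_lim (mom_lim 0%N)); rewrite -cvg_shiftS.
  rewrite (_ : [sequence _]_n = (fun=> 1)); first exact: cvg_cst.
  apply/funext => d /=; have [s ss ->] := real_rooted_split (p_real_rooted d.+1 isT).
  rewrite /poly_moment sum_roots_with_mult big_const_seq count_predT ss iter_addr_0.
  by rewrite mulVf // pnatr_eq0.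
have mr j : (0 < j)%N -> m j = genus_sum r j 0.
  by move=> j0; rewrite genus0_noncrossing // /r -free_moment_cumulant.
have mE n d : (0 < n)%N -> (0 < d)%N -> poly_moment d (p d) n = moment_expansion K n d.
  move=> n0 d0; rewrite (poly_moment_ff d0 (p_real_rooted d d0) n0).
  by rewrite ff_moment_genus // pnatr_eq0 -lt0n.
have mK n : (0 < n)%N -> fluct (moment_expansion K n) (m n) (mu' 'X^n).
  by move=> n0; apply: eq_fluct (mom_fluct n n0) => d; exact: mE.
have Kr n : (0 < n)%N -> has_fluct (fun d => K d n) (r n).
  by apply: (has_fluct_cumulant mr) => // j j0; exists (mu' 'X^j); exact: mK.
split.
  have /choice[rho Hrho] : forall n, exists x, (0 < n)%N -> fluct (fun d => K d n) (r n) x.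
    by case=> [|n]; [exists 0|have [x Hx] := Kr n.+1 isT; exists x].
  by exists rho => n n0; apply/fluct_littleo/Hrho.
move=> rhat Hrhat G_mu G_mu' Rhat H_mu.
have {}Kr n : (0 < n)%N -> fluct (fun d => K d n) (r n) (rhat n).
  by move=> n0; apply/fluct_littleo/Hrhat.
have Kup n : fluct_upto K r n by move=> j /andP[j0 _]; exists (rhat j); exact: Kr.
have /choice[delta Hdelta] : forall n, exists x, fluct (fun d => leading_moment (K d) n) (m n) x.
  case=> [|n]; first by exists 0; rewrite m0; exact: fluct_cst.
  by rewrite mr //; exact: has_fluct_genus_sum.
have delta0 : delta 0%N = 0.
  by apply: fluct_unique (Hdelta 0%N) _; rewrite m0; exact: fluct_cst.
have mu'E n : (0 < n)%N -> mu' 'X^n = delta n - annular_coef r n.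
  move=> n0; apply: fluct_unique (mK n n0) _; rewrite mr //.
  apply: fluct_moment_expansion => //; rewrite -mr //.
  by have := Hdelta n; case: n n0.
pose gam : fps R := cauchy_series delta.
have gamE : gam = - (fps_comp Rhat G_mu : fps R) * dz (G_mu : fps R).
  apply: (@linearised_equation _ K r rhat (fun d => cauchy_series (leading_moment (K d)))) => //.
  - by case=> [|n]; [exact: fluct_cst|exact: Hdelta].
  - by move=> N d; exact: leading_equation.
  - suff -> : G_mu = cauchy_series (leading_moment r) by exact: leading_equation.
    by apply/funext => -[|[|n]]; rewrite /G_mu /= ?m0 ?mr.
have -> : - fps_mul (fps_comp Rhat G_mu) (fps_deriv_inv G_mu) = gam by rewrite gamE mulNr.
apply/funext => k; transitivity (gam k - H_mu k); last by [].
case: k => [|[|[|n]]] /=.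
- by rewrite subr0.
- by rewrite delta0 expr0 mu'1 subr0.
- rewrite -['X]expr1 mu'E //; congr (_ - _); rewrite /annular_coef.
  rewrite big1 ?mulr0 // => t _; rewrite big_pred0 // => s.
  by case: t s => [[|[|t]] ?] [[|[|s]] ?].
- by rewrite mu'E.
Qed.
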